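(* There is no finite ring $R$ such that the unit graph $G(R)$ is projective.
   Context: All rings are commutative with non-zero identity. $U(R)$ is the group of units of $R$. The unit graph $G(R)$ is the simple graph with vertex set $R$ in which two distinct vertices $x,y$ are adjacent if and only if $x+y\in U(R)$. The nonorientable genus (crosscap number) of a finite simple graph is the minimum non-negative integer $k$ such that the graph can be embedded in the sphere with $k$ crosscaps (the case $k=0$ being the sphere itself). A graph is projective if its nonorientable genus equals $1$ (so planar graphs are not projective). *)

(* Defs.v *)
From HB Require Import structures.
From mathcomp Require Import all_boot all_order all_algebra.
From mathcomp Require Import generic_quotient.
From mathcomp Require Import all_classical all_reals all_analysis.
From mathcomp Require Import ring lra.

Set Implicit Arguments.
Unset Strict Implicit.
Unset Printing Implicit Defensive.

Import Order.TTheory GRing.Theory Num.Theory.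
Import numFieldNormedType.Exports.
Local Open Scope classical_set_scope.
Local Open Scope ring_scope.
Local Open Scope quotient_scope.

Record sgraph := SGraph {
  vertex :> finType;
  adj : rel vertex;
  adj_sym : symmetric adj;
  adj_irr : irreflexive adj }.

Section UnitGraph.
Variable R : finComUnitRingType.

Definition unit_adj : rel R :=
  fun x y => (x != y) && (x + y \is a GRing.unit).

Lemma unit_adj_sym : symmetric unit_adj.
Proof. by move=> x y; rewrite /unit_adj eq_sym addrC. Qed.

Lemma unit_adj_irr : irreflexive unit_adj.
Proof. by move=> x; rewrite /unit_adj eqxx. Qed.

Definition unit_graph : sgraph := SGraph unit_adj_sym unit_adj_irr.

End UnitGraph.

Section CrosscapSphere.
Variable K : realType.

Definition dot (x y : 'rV[K]_3) : K := \sum_(i < 3) x ord0 i * y ord0 i.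

(* [k] pairwise disjoint closed caps                                           *)
(* [{x | cap_height i <= dot x (cap_center i)}] of the unit sphere of K^3,     *)
(* each bounded by a nondegenerate circle.                                     *)
Record caps (k : nat) := Caps {
  cap_center : 'I_k -> 'rV[K]_3;
  cap_height : 'I_k -> K;
  cap_center_sphere : forall i, dot (cap_center i) (cap_center i) = 1;
  cap_height_bound : forall i, -1 < cap_height i < 1;
  caps_disjoint : forall i j x, dot x x = 1 ->
    cap_height i <= dot x (cap_center i) ->
    cap_height j <= dot x (cap_center j) -> i = j }.

Variables (k : nat) (C : caps k).

Definition punctured_sphere : set 'rV[K]_3 :=
  [set x | dot x x = 1 /\ forall i, dot x (cap_center C i) <= cap_height C i].

Local Notation T := (set_type punctured_sphere).

(* Opposite points of each boundary circle are identified: the circle bounding *)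
(* the [i]-th cap has centre [cap_height C i *: cap_center C i], so the point  *)
(* opposite to [x] on it is [(2 * cap_height C i) *: cap_center C i - x].      *)
Definition crosscap_glue : rel T := fun x y =>
  (x == y) || [exists i, (dot (val x) (cap_center C i) == cap_height C i) &&
                (val y == (2 * cap_height C i) *: cap_center C i - val x)].

Lemma dotBZ (a : K) (c x : 'rV[K]_3) :
  dot (a *: c - x) c = a * dot c c - dot x c.
Proof.
rewrite /dot mulr_sumr -sumrB; apply: eq_bigr => i _.
by rewrite !mxE mulrBl mulrA.
Qed.

Lemma crosscap_opp (i : 'I_k) (x : 'rV[K]_3) :
  dot x (cap_center C i) = cap_height C i ->
  dot ((2 * cap_height C i) *: cap_center C i - x) (cap_center C i) =
  cap_height C i.
Proof.
by move=> xh; rewrite dotBZ cap_center_sphere mulr1 xh mulr2n mulrDl mul1r addrK.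
Qed.

Lemma crosscap_glue_refl : reflexive crosscap_glue.
Proof. by move=> x; rewrite /crosscap_glue eqxx. Qed.

Lemma crosscap_glue_symW x y : crosscap_glue x y -> crosscap_glue y x.
Proof.
move=> /orP[/eqP -> | /existsP[i /andP[/eqP xi /eqP yE]]].
  exact: crosscap_glue_refl.
apply/orP; right; apply/existsP; exists i.
by rewrite yE crosscap_opp // eqxx subKr eqxx.
Qed.

Lemma crosscap_glue_sym : symmetric crosscap_glue.
Proof. by move=> x y; apply/idP/idP; exact: crosscap_glue_symW. Qed.

Lemma crosscap_glue_trans : transitive crosscap_glue.
Proof.
move=> y x z xy; case/orP: (xy) => [/eqP -> //|].
move=> /existsP[i /andP[/eqP xi /eqP yE]].
move=> /orP[/eqP <- //| /existsP[j /andP[/eqP yj /eqP zE]]].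
have [y1 _] : punctured_sphere (val y) by apply: set_mem; exact: valP.
have ij : i = j.
  apply: (caps_disjoint (c := C) y1); last by rewrite yj.
  by rewrite yE crosscap_opp.
by apply/orP; left; apply/eqP/val_inj; rewrite zE yE -ij subKr.
Qed.

Definition crosscap_rel : equiv_rel T :=
  EquivRel _ crosscap_glue_refl crosscap_glue_sym crosscap_glue_trans.

(* The sphere with [k] crosscaps; up to homeomorphism it does not depend on    *)
(* the choice of the caps, and for [k = 0] it is the sphere.                   *)
Definition crosscap_sphere : topologicalType :=
  quotient_topology {eq_quot crosscap_rel}.

End CrosscapSphere.

Section CapsExist.
Variable K : realType.

Lemma caps_exist (k : nat) : inhabited (caps K k).
Proof.
pose c (i : 'I_k) : 'rV[K]_3 := let s := i%:R in \row_(j < 3)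
  [:: (1 - s^+2)/(1 + s^+2); 2 * s / (1 + s^+2); 0]`_j.
pose e : K := (4 * (1 + k%:R^+2)^+2)^-1.
have dE (x y : 'rV[K]_3) : dot x y = x ord0 0 * y ord0 0 + x ord0 1 * y ord0 1 + x ord0 2%:R * y ord0 2%:R.
  rewrite /dot !big_ord_recl big_ord0 addr0 addrA.
  congr (_ + _ * _ + _ * _); congr (_ _ _); exact/val_inj.
have p (s : K) : 1 + s^+2 != 0 by apply: lt0r_neq0; rewrite ltr_pwDl // sqr_ge0.
have cc i j : dot (c i) (c j) = ((1 - i%:R^+2)*(1 - j%:R^+2) + 4 * i%:R * j%:R) / ((1 + i%:R^+2)*(1 + j%:R^+2)).
  rewrite dE !mxE /=; field; by rewrite !p.
have kp : 1 <= (1 + k%:R^+2 : K) by rewrite lerDl sqr_ge0.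
have e0 : 0 < e by rewrite invr_gt0; nra.
have e1 : e <= 1/4.
  rewrite /e invfM; have : (((1 + k%:R ^+ 2) ^+ 2)^-1 : K) <= 1 by rewrite invf_le1; nra.
  lra.
have cs i : dot (c i) (c i) = 1 by rewrite cc; field; rewrite p.
suff H i j x : dot x x = 1 -> 1 - e <= dot x (c i) -> 1 - e <= dot x (c j) -> i = j.
  by split; exact: (@Caps K k c (fun=> 1 - e) cs (fun=> ltac:(apply/andP; split; lra)) H).
move=> xx xi xj; apply/eqP/contraT => ij; exfalso.
have D : 2 - 2 * dot (c i) (c j) <= 8 * e.
  have := cs i; have := cs j; move: xx xi xj; rewrite !dE.
  move: (x _ _) (x _ _) (x _ _) (c i _ _) (c i _ _) (c i _ _) (c j _ _) (c j _ _) (c j _ _) => x1 x2 x3 a1 a2 a3 b1 b2 b3 *.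
  have : 0 <= (2*x1-a1-b1)^+2 + (2*x2-a2-b2)^+2 + (2*x3-a3-b3)^+2 by rewrite !addr_ge0 ?sqr_ge0.
  lra.
have E : 2 - 2 * dot (c i) (c j) = 4 * (i%:R - j%:R)^+2 / ((1 + i%:R^+2)*(1 + j%:R^+2)).
  by rewrite cc; field; rewrite !p.
have N : 1 <= ((i%:R - j%:R)^+2 : K).
  rewrite -[i%:R]/((i : nat)%:Z%:~R) -[j%:R]/((j : nat)%:Z%:~R) -rmorphB -rmorphXn /= (_ : 1 = 1%:~R) // ler_int.
  rewrite -gtz0_ge1 lt_def sqr_ge0 andbT sqrf_eq0 subr_eq0; apply: contra ij => /eqP[] ?; exact/eqP/val_inj.
have b (l : 'I_k) : 0 < (1 + l%:R^+2 : K) <= 1 + k%:R^+2.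
  rewrite ltr_pwDl ?sqr_ge0 //= lerD2l lerXn2r ?nnegrE ?ler0n // ler_nat; exact: ltnW.
move: D; rewrite E ler_pdivrMr; last by have /andP[? _] := b i; have /andP[? _] := b j; rewrite mulr_gt0.
have : (1 + i%:R^+2)*(1 + j%:R^+2) <= (1 + k%:R^+2)^+2 :> K.
  have /andP[? ?] := b i; have /andP[? ?] := b j; rewrite expr2; apply: ler_pM => //; exact: ltW.
have E2 : 4 * e * (1 + k%:R^+2)^+2 = 1 by rewrite /e; field; rewrite p.
move=> L L2; have : 4 * e * ((1 + i%:R^+2)*(1 + j%:R^+2)) <= 1.
  by rewrite -[leRHS]E2; apply: ler_wpM2l => //; lra.
by move: (_ * (1 + j%:R^+2)) L2 N => q; nra.
Qed.

End CapsExist.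

Section Embedding.
Variable K : realType.

(* The edge [x y] is drawn as the simple arc [arc x y] from [pt x] to [pt y].  *)
Record embedding (G : sgraph) (X : topologicalType)
    (pt : G -> X) (arc : G -> G -> K -> X) : Prop := Embedding {
  pt_inj : injective pt;
  arc_continuous : forall x y, adj x y ->
    {within `[0, 1], continuous (arc x y)};
  arc_inj : forall x y, adj x y -> {in `[0, 1] &, injective (arc x y)};
  arc_start : forall x y, adj x y -> arc x y 0 = pt x;
  arc_end : forall x y, adj x y -> arc x y 1 = pt y;
  arc_rev : forall x y, adj x y ->
    forall t : K, t \in `[0, 1] -> arc y x t = arc x y (1 - t);
  arc_vertex : forall x y z, adj x y ->
    forall t : K, t \in `]0, 1[ -> arc x y t <> pt z;
  arc_disjoint : forall x y z w, adj x y -> adj z w ->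
    forall s t : K, s \in `]0, 1[ -> t \in `]0, 1[ -> arc x y s = arc z w t ->
    (z = x /\ w = y) \/ (z = y /\ w = x) }.

Definition embeddable (G : sgraph) (X : topologicalType) : Prop :=
  exists pt arc, @embedding G X pt arc.

Definition crosscap_embeddable (G : sgraph) (k : nat) : Prop :=
  exists C : caps K k, embeddable G (crosscap_sphere C).

Definition is_nonorientable_genus (G : sgraph) (k : nat) : Prop :=
  crosscap_embeddable G k /\
  forall j, crosscap_embeddable G j -> (k <= j)%N.

Definition projective (G : sgraph) : Prop := is_nonorientable_genus G 1.

End Embedding.

(* Main.v *)
Require Import Defs.
From mathcomp Require Import all_boot all_order all_algebra fingroup pgroup.
From mathcomp Require Import generic_quotient.
From mathcomp Require Import all_classical all_reals all_analysis.
From mathcomp Require Import zify.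
From Stdlib Require Import Ring.

Set Implicit Arguments.
Unset Strict Implicit.
Unset Printing Implicit Defensive.

Import Order.TTheory GRing.Theory Num.Theory.
Import numFieldNormedType.Exports.

(** Every unit graph of a finite ring is either planar or impossible to draw in
    the projective plane, so none has crosscap number 1.

    Impossibility is proved through the mod 2 intersection form of the
    projective plane, so that no Euler formula and no Jordan curve theorem are
    used.  Seen from the centre of the boundary circle of the removed cap, the
    sphere with one crosscap becomes the space of lines of a 3-dimensional space
    [crosscap_line_chart].
    In a drawing, the arcs of two edges without common end are disjoint compact
    sets, hence at positive distance.  They can be replaced by close polygonal
    curves in general position, where they still do not meet
    [generic_perturbation, near_no_cross].  Two closed curves of the projective
    plane meet an odd number of times exactly when both are one-sided.  Close up
    the curve of each edge through a fixed point, and let y(e) say whether the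
    result is one-sided.  Counting the crossings that the closing up creates
    gives [path_equation]: for all edges ab and cd without common end
      y(ab) y(cd) = x(ab,c) + x(ab,d) + x(cd,a) + x(cd,b)
                    + o(a,c) + o(a,d) + o(b,c) + o(b,d)   (mod 2),
    with x(e,v) the number of times that e passes over v and o a tournament on
    the vertices.  This is [crosscap_system].  Summed over the pairs of
    independent paths of a subdivision of K_{3,3}, the x cancel and the o add up
    to 1, so the sum of the products y(e) y(f) is 1.  For seven small graphs, a
    few subdivisions of K_{3,3} already contradict one another for every y, which
    is checked by evaluation [refuted_not_subgraph].

    The ring theory splits a finite ring by its atoms, the minimal idempotents e.
    Each corner eR is local, and the element x is a unit as soon as it is one in
    complementary corners [unit_glue].  Let J be the radical.
    - If J has at least 4 elements, 0 + J and 1 + J span K_{4,4}; if it has 3,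
      then J and the two cosets of 1 and -1 span K_{3,6}.
    - If J has 2 elements, it lives in one corner, of order 4.  Another corner
      with at least 3 elements gives a hexagon with all vertices doubled.
    - If J = 0, the corners are fields.  Two of them with at least 3 elements are
      too many, except for the 9 element ring made of two fields of order 3.  A
      single one may have at most 4 elements, or 5 if it is the whole ring.
    In the remaining rings the graph is one of a complete graph on at most 4
    vertices, a wheel, a graph on 9 vertices, or a disjoint union of subgraphs of
    a cube; these are drawn with straight segments [straight_line_planar]. *)

(** * Arithmetic modulo 2 *)

Lemma addb_ring : ring_theory false true addb andb addb id (@eq bool).
Proof. by split=> //; do 3?[case]. Qed.

Lemma eqb_ok b c : Bool.eqb b c = true -> b = c. Proof. by case: b; case: c. Qed.

Ltac bool_cst t :=
  match t with true => t | false => t | _ => constr:(NotConstant) end.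

(* Boolean coefficients make the normalisation aware of a (+) a = false. *)
Add Ring addb_ring : addb_ring (decidable eqb_ok, constants [bool_cst]).

(** The goal may mention bool through a canonical structure; ring looks for the
    bare type. *)
Ltac bool_eq := match goal with |- @eq _ ?a ?b => change (@eq bool a b) end.
Tactic Notation "F2_ring" := bool_eq; ring.
Tactic Notation "F2_ring" "[" constr(H) "]" := bool_eq; ring [H].

From mathcomp Require Import ring lra.

(** * The crossing system of a graph *)

Definition interlace (o : rel nat) (e f : nat * nat) : bool :=
  o e.1 f.1 (+) o e.1 f.2 (+) (o e.2 f.1 (+) o e.2 f.2).

(** The mod 2 shadow of a drawing in the projective plane: y a b tells whether
    the edge ab, closed up through a base point, is one-sided, x a b v counts
    its crossings with the ray from the base point to v, and o compares
    directions around the base point. *)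
Definition crosscap_system (V : eqType) (adj : rel V) : Prop :=
  exists (y : V -> V -> bool) (x : V -> V -> V -> bool) (o : rel V),
    (forall v w, v != w -> o w v = ~~ o v w) /\
    forall a b c d, adj a b -> adj c d -> uniq [:: a; b; c; d] ->
      y a b && y c d =
      x a b c (+) x a b d (+) (x c d a (+) x c d b) (+)
      (o a c (+) o a d (+) (o b c (+) o b d)).

Section Refutation.
Implicit Types (L t : seq (nat * nat)) (s : seq ((nat * nat) * (nat * nat))).

Definition indep (e f : nat * nat) := uniq [:: e.1; e.2; f.1; f.2].

(** The system for vertices named by integers, with o the order of the
    integers. *)
Definition normal_system L (y : nat * nat -> bool)
    (x : (nat * nat) * nat -> bool) : Prop :=
  forall e f, e \in L -> f \in L -> indep e f ->
    y e && y f = x (e, f.1) (+) x (e, f.2) (+) (x (f, e.1) (+) x (f, e.2)) (+)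
                 interlace ltn e f.

(** Edges are written with their smaller end first. *)
Definition steps (p : seq nat) : seq (nat * nat) :=
  [seq (minn e.1 e.2, maxn e.1 e.2) | e <- zip p (behead p)].

(** A subdivision of K_{3,3} is a table with 3 rows and 3 columns: the entry
    (i, j) is the path from the branch vertex i on one side to the branch
    vertex j on the other. Paths in different rows and columns have no common
    end. *)
Definition k33_pairs (P : seq (seq (seq nat))) : seq ((nat * nat) * (nat * nat)) :=
  let path ij := steps (nth [::] (nth [::] P ij.1) ij.2) in
  let grid := [seq (i, j) | i <- iota 0 3, j <- iota 0 3] in
  flatten [seq [seq (e, f) | e <- path ij.1, f <- path ij.2] |
    ij <- [seq (ij, kl) | ij <- grid, kl <- grid] &
          (ij.1.1 < ij.2.1) && (ij.1.2 != ij.2.2)].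

Definition incidences s : seq ((nat * nat) * nat) :=
  flatten [seq [:: (ef.1, ef.2.1); (ef.1, ef.2.2); (ef.2, ef.1.1); (ef.2, ef.1.2)]
          | ef <- s].

Definition parity T (F : T -> bool) (r : seq T) := foldr (fun z b => F z (+) b) false r.

(** The relations among the equations of the system: in the sum of the
    equations of such a family of pairs every unknown x cancels and the
    constant term is 1. *)
Definition odd_closed L s :=
  [&& all (fun ef => [&& ef.1 \in L, ef.2 \in L & indep ef.1 ef.2]) s,
      all (fun m => ~~ odd (count_mem m (incidences s))) (incidences s)
    & parity (fun ef => interlace ltn ef.1 ef.2) s].

Definition edge_form (y : nat * nat -> bool) s := parity (fun ef => y ef.1 && y ef.2) s.

Lemma parityE T (F : T -> bool) r : parity F r = \big[addb/false]_(z <- r) F z.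
Proof. by elim: r => [|z s IH]; rewrite ?big_nil // big_cons /= IH. Qed.

Lemma iterop_addb n b : iterop n addb b false = odd n && b.
Proof. by rewrite Monoid.iteropE; elim: n => //= n ->; case: b; case: (odd n). Qed.

Lemma parity_even (T : eqType) (F : T -> bool) r :
  all (fun m => ~~ odd (count_mem m r)) r -> parity F r = false.
Proof.
move=> /allP ev; rewrite parityE -big_undup_iterop_count big_seq big1 // => m.
by rewrite mem_undup iterop_addb => /ev /negPf->.
Qed.

Lemma odd_closed_edge_form L s y x :
  odd_closed L s -> normal_system L y x -> edge_form y s.
Proof.
case/and3P=> /allP inL ev oddI sys.
have incidencesE : parity x (incidences s) = parity (fun ef => x (ef.1, ef.2.1) (+)
    x (ef.1, ef.2.2) (+) (x (ef.2, ef.1.1) (+) x (ef.2, ef.1.2))) s.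
  by elim: s {inL ev oddI} => //= ef s <-; rewrite !addbA.
have {}ev := parity_even x ev.
suff : edge_form y s (+) parity (fun ef => interlace ltn ef.1 ef.2) s = false.
  by rewrite [parity _ _]oddI addbT => /negbFE.
rewrite -ev incidencesE /edge_form !parityE -big_split /= !big_seq.
apply: eq_bigr => ef /inL/and3P[e1 e2 e12].
by rewrite (sys _ _ e1 e2 e12) /= addbK.
Qed.

(** A spanning tree of the component of the initial vertex, last edge first and
    oriented away from that vertex; k bounds the number of steps. *)
Fixpoint grow k (seen : seq nat) t L :=
  if k is k'.+1 then
    if [seq e <- L | (e.1 \in seen) != (e.2 \in seen)] is e :: _ then
      let: (p, v) := if e.1 \in seen then e else (e.2, e.1) in
      grow k' (v :: seen) ((p, v) :: t) L
    else t
  else t.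

Fixpoint is_tree t : bool :=
  if t is (p, v) :: t' then
    [&& v != p, all (fun e => (v != e.1) && (v != e.2)) t' & is_tree t']
  else true.

Definition tree_of L := grow (size L) [:: (head (0, 0) L).1] [::] L.

(** Reversing the lift of a vertex changes y on all edges at this vertex, so y
    can be made zero on a tree: solve for the vertices in the order in which
    the tree reaches them. *)
Lemma tree_potential (z : nat * nat -> bool) t : is_tree t ->
  exists s : nat -> bool, forall e, e \in t -> s e.1 (+) s e.2 = z e.
Proof.
elim: t => [|[p v] t IH] /=; first by exists (fun=> false).
case/and3P=> vp /allP vt /IH[s sP].
exists (fun w => if w == v then s p (+) z (p, v) else s w) => e.
rewrite inE => /predU1P[->|te] /=.
  by rewrite eqxx eq_sym (negPf vp) addbA addbb addFb.
by have /andP[v1 v2] := vt e te; rewrite ![_ == v]eq_sym (negPf v1) (negPf v2) sP.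
Qed.

Fixpoint all_bits n : seq (seq bool) :=
  if n is n'.+1 then
    [seq false :: l | l <- all_bits n'] ++ [seq true :: l | l <- all_bits n']
  else [:: [::]].

Lemma mem_all_bits l : l \in all_bits (size l).
Proof.
by elim: l => //= -[] l IH; rewrite mem_cat map_f ?orbT.
Qed.

Definition sort_edge (e : nat * nat) := (minn e.1 e.2, maxn e.1 e.2).

Definition free_edges L :=
  let t := map sort_edge (tree_of L) in [seq e <- L | e \notin t].

Definition k33_edges (Ps : seq (seq (seq (seq nat)))) : seq (nat * nat) :=
  undup (flatten (map steps (flatten (flatten Ps)))).

(** For each value of y off a spanning tree, one of the given subdivisions of
    K_{3,3} has an even sum of products. *)
Definition refuted (Ps : seq (seq (seq (seq nat)))) : bool :=
  let L := k33_edges Ps in let F := free_edges L in let S := map k33_pairs Ps in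
  [&& is_tree (tree_of L), all (fun e => e.1 < e.2) L,
      all (fun e => sort_edge e \in L) (tree_of L),
      all (odd_closed L) S
    & all (fun l => has (fun s => ~~ edge_form (fun e => nth false l (index e F)) s) S)
          (all_bits (size F))].

Variables (V : eqType) (adj : rel V).

(** Two normalisations reduce the general system to the computation. Replacing
    o by the order of the integers changes x(e,v) by the number of ends of e
    that compare differently with v. Reversing the lifts in a set s of vertices
    changes y(ab) to y(ab) + s(a) + s(b), which is absorbed by x as well; the
    mixed terms s(v) s(w) are split between the two edges according to the
    order of v and w, and both corrections are collected in w. *)
Lemma refuted_not_subgraph Ps (f : nat -> V) : refuted Ps ->
  let L := k33_edges Ps in
  {in [pred i | has (fun e => (i == e.1) || (i == e.2)) L] &, injective f} ->
  {in L, forall e, adj (f e.1) (f e.2)} -> ~ crosscap_system adj.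
Proof.
move=> /[swap] L; case/and5P=> tr /allP lt_L /allP trL /allP cl /allP ref f_inj f_adj.
case=> y0 [x0 [above [aboveC sys]]].
pose z e := y0 (f (sort_edge e).1) (f (sort_edge e).2).
have [s sP] := tree_potential z tr.
pose y e := y0 (f e.1) (f e.2) (+) (s e.1 (+) s e.2).
(* w v u is nonzero only for v < u, so each unordered pair contributes once *)
pose w (v u : nat) := (v < u) && (~~ above (f v) (f u) (+) (s v && s u)).
pose x (m : (nat * nat) * nat) := let: (e, v) := m in
  x0 (f e.1) (f e.2) (f v) (+) (s v && y0 (f e.1) (f e.2)) (+) (w e.1 v (+) w e.2 v).
have vL e : e \in L -> (e.1 \in [pred i | has (fun e => (i == e.1) || (i == e.2)) L]) /\
   (e.2 \in [pred i | has (fun e => (i == e.1) || (i == e.2)) L]).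
  by move=> eL; split; apply/hasP; exists e => //; rewrite eqxx ?orbT.
have nsys : normal_system L y x.
  move=> e g eL gL; rewrite /indep => ueg.
  have ug : uniq (map f [:: e.1; e.2; g.1; g.2]).
    rewrite map_inj_in_uniq // => i j iI jI; apply: f_inj.
      by move: iI; rewrite !inE => /or4P[]/eqP->; case: (vL _ eL); case: (vL _ gL).
    by move: jI; rewrite !inE => /or4P[]/eqP->; case: (vL _ eL); case: (vL _ gL).
  have /= := sys _ _ _ _ (f_adj e eL) (f_adj g gL) ug.
  have oE i j : f i != f j -> i != j -> above (f i) (f j) = (i < j) (+)
      (w i j (+) (w j i)) (+) (s i && s j).
    move=> fij; rewrite /w neq_ltn; case: ltngtP => // ij _; rewrite ?addbF /=.
      by case: (above _ _); case: (s i); case: (s j).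
    by rewrite (aboveC _ _ fij); case: (above _ _); case: (s i); case: (s j).
  move: ueg ug; rewrite /= !inE !negb_or !andbT.
  case/and3P=> /and3P[ab ac ad] /andP[bc bd] cd.
  case/and3P=> /and3P[fab fac fad] /andP[fbc fbd] fcd.
  rewrite !oE // /y /x /interlace /= => {}sys.
  F2_ring [sys].
have := mem_all_bits (map y (free_edges L)); rewrite size_map.
case/ref/hasP=> S SP /negP; apply.
apply: odd_closed_edge_form (cl S SP) _ => e g eL gL eg.
suff yE h : h \in L -> nth false (map y (free_edges L)) (index h (free_edges L)) = y h.
  by rewrite !yE //; exact: nsys.
move=> hL; case: (boolP (h \in free_edges L)) => hF.
  by rewrite (nth_map (0, 0)) ?index_mem // nth_index.
rewrite nth_default ?size_map ?memNindex //.
move: hF; rewrite mem_filter hL andbT negbK => /mapP[[p v] tpv hE].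
have := sP _ tpv; rewrite /z -hE /y hE /sort_edge /= => <-.
by rewrite /minn /maxn; case: ltnP => _ /=; F2_ring.
Qed.
End Refutation.

(** Subdivisions inside K_{4,4} minus an edge, with sides 0..3 and 4..7. *)
Definition k44_minus_edge := [::
    [:: [:: [:: 0; 5]; [:: 0; 6]; [:: 0; 7]];
       [:: [:: 1; 5]; [:: 1; 4; 3; 6]; [:: 1; 7]];
       [:: [:: 2; 5]; [:: 2; 6]; [:: 2; 7]]];
    [:: [:: [:: 4; 1]; [:: 4; 0; 7; 2]; [:: 4; 3]];
       [:: [:: 5; 1]; [:: 5; 2]; [:: 5; 3]];
       [:: [:: 6; 1]; [:: 6; 2]; [:: 6; 3]]];
    [:: [:: [:: 0; 4]; [:: 0; 6]; [:: 0; 7]];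
       [:: [:: 1; 4]; [:: 1; 6]; [:: 1; 7]];
       [:: [:: 2; 5; 3; 4]; [:: 2; 6]; [:: 2; 7]]];
    [:: [:: [:: 0; 4]; [:: 0; 5]; [:: 0; 7; 1; 6]];
       [:: [:: 2; 4]; [:: 2; 5]; [:: 2; 6]];
       [:: [:: 3; 4]; [:: 3; 5]; [:: 3; 6]]]].

Lemma k44_minus_edge_refuted : refuted k44_minus_edge.
Proof. by vm_compute. Qed.

(** Subdivisions inside K_{3,5}, with sides 0..2 and 3..7. *)
Definition k35 := [::
    [:: [:: [:: 0; 4]; [:: 0; 5]; [:: 0; 7]];
       [:: [:: 1; 4]; [:: 1; 5]; [:: 1; 7]];
       [:: [:: 2; 4]; [:: 2; 5]; [:: 2; 7]]];
    [:: [:: [:: 0; 3]; [:: 0; 5]; [:: 0; 6]];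
       [:: [:: 1; 3]; [:: 1; 5]; [:: 1; 6]];
       [:: [:: 2; 3]; [:: 2; 5]; [:: 2; 6]]];
    [:: [:: [:: 0; 4]; [:: 0; 6]; [:: 0; 7]];
       [:: [:: 1; 4]; [:: 1; 6]; [:: 1; 7]];
       [:: [:: 2; 4]; [:: 2; 6]; [:: 2; 7]]];
    [:: [:: [:: 0; 3]; [:: 0; 4]; [:: 0; 7]];
       [:: [:: 1; 3]; [:: 1; 4]; [:: 1; 7]];
       [:: [:: 2; 3]; [:: 2; 4]; [:: 2; 7]]]].

Lemma k35_refuted : refuted k35.
Proof. by vm_compute. Qed.

(** Subdivisions inside K_{1,2,2,2}, with parts 0, 12, 34 and 56. *)
Definition k1222 := [::
    [:: [:: [:: 0; 1]; [:: 0; 2]; [:: 0; 5]];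
       [:: [:: 4; 1]; [:: 4; 2]; [:: 4; 5]];
       [:: [:: 6; 1]; [:: 6; 2]; [:: 6; 3; 5]]];
    [:: [:: [:: 1; 3]; [:: 1; 4]; [:: 1; 5]];
       [:: [:: 2; 3]; [:: 2; 4]; [:: 2; 5]];
       [:: [:: 6; 3]; [:: 6; 4]; [:: 6; 0; 5]]];
    [:: [:: [:: 0; 1]; [:: 0; 2]; [:: 0; 6]];
       [:: [:: 3; 1]; [:: 3; 2]; [:: 3; 6]];
       [:: [:: 5; 1]; [:: 5; 2]; [:: 5; 4; 6]]];
    [:: [:: [:: 1; 3]; [:: 1; 4]; [:: 1; 6]];
       [:: [:: 2; 3]; [:: 2; 4]; [:: 2; 6]];
       [:: [:: 5; 3]; [:: 5; 4]; [:: 5; 0; 6]]];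
    [:: [:: [:: 0; 3; 1]; [:: 0; 2]; [:: 0; 4]];
       [:: [:: 5; 1]; [:: 5; 2]; [:: 5; 4]];
       [:: [:: 6; 1]; [:: 6; 2]; [:: 6; 4]]];
    [:: [:: [:: 0; 3]; [:: 0; 5]; [:: 0; 6]];
       [:: [:: 1; 3]; [:: 1; 5]; [:: 1; 6]];
       [:: [:: 2; 3]; [:: 2; 5]; [:: 2; 6]]]].

Lemma k1222_refuted : refuted k1222.
Proof. by vm_compute. Qed.

(** Subdivisions inside K_{4,5} minus a matching: a and 4 + b are adjacent when
    a differs from b. *)
Definition k45_minus_matching := [::
    [:: [:: [:: 0; 6]; [:: 0; 7]; [:: 0; 8]];
       [:: [:: 1; 6]; [:: 1; 7]; [:: 1; 8]];
       [:: [:: 3; 6]; [:: 3; 4; 2; 7]; [:: 3; 8]]];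
    [:: [:: [:: 4; 1]; [:: 4; 2]; [:: 4; 3]];
       [:: [:: 7; 1]; [:: 7; 2]; [:: 7; 0; 6; 3]];
       [:: [:: 8; 1]; [:: 8; 2]; [:: 8; 3]]];
    [:: [:: [:: 0; 5]; [:: 0; 7]; [:: 0; 8]];
       [:: [:: 2; 5]; [:: 2; 7]; [:: 2; 8]];
       [:: [:: 3; 5]; [:: 3; 6; 1; 7]; [:: 3; 8]]];
    [:: [:: [:: 0; 6; 1; 4]; [:: 0; 5]; [:: 0; 8]];
       [:: [:: 2; 4]; [:: 2; 5]; [:: 2; 8]];
       [:: [:: 3; 4]; [:: 3; 5]; [:: 3; 8]]]].

Lemma k45_minus_matching_refuted : refuted k45_minus_matching.
Proof. by vm_compute. Qed.

(** Subdivisions inside the cube, seen as K_{4,4} minus a perfect matching,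
    with the vertices of one side doubled: a is adjacent to 4 + 2 b and 5 + 2 b
    when a differs from b. *)
Definition half_doubled_cube := [::
    [:: [:: [:: 0; 9; 1]; [:: 0; 6; 2]; [:: 0; 7; 3]];
       [:: [:: 4; 1]; [:: 4; 2]; [:: 4; 3]];
       [:: [:: 5; 1]; [:: 5; 2]; [:: 5; 3]]];
    [:: [:: [:: 0; 10; 1; 4]; [:: 0; 6]; [:: 0; 7]];
       [:: [:: 2; 4]; [:: 2; 6]; [:: 2; 7]];
       [:: [:: 3; 4]; [:: 3; 6]; [:: 3; 7]]];
    [:: [:: [:: 0; 9; 1]; [:: 0; 7; 2]; [:: 0; 6; 3]];
       [:: [:: 4; 1]; [:: 4; 2]; [:: 4; 3]];
       [:: [:: 5; 1]; [:: 5; 2]; [:: 5; 3]]];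
    [:: [:: [:: 1; 4]; [:: 1; 5]; [:: 1; 10]];
       [:: [:: 2; 4]; [:: 2; 5]; [:: 2; 10]];
       [:: [:: 3; 4]; [:: 3; 5]; [:: 3; 9; 0; 10]]];
    [:: [:: [:: 0; 6]; [:: 0; 7]; [:: 0; 9]];
       [:: [:: 2; 6]; [:: 2; 7]; [:: 2; 10; 1; 9]];
       [:: [:: 3; 6]; [:: 3; 7]; [:: 3; 9]]]].

Lemma half_doubled_cube_refuted : refuted half_doubled_cube.
Proof. by vm_compute. Qed.

(** Subdivisions inside the hexagon with all vertices doubled: 2 a + s is
    adjacent to 6 + 2 b + t when a differs from b. *)
Definition doubled_hexagon := [::
    [:: [:: [:: 4; 6]; [:: 4; 7]; [:: 4; 9]];
       [:: [:: 5; 6]; [:: 5; 7]; [:: 5; 9]];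
       [:: [:: 11; 2; 6]; [:: 11; 3; 7]; [:: 11; 1; 10; 0; 9]]];
    [:: [:: [:: 0; 9]; [:: 0; 10]; [:: 0; 11]];
       [:: [:: 1; 9]; [:: 1; 10]; [:: 1; 11]];
       [:: [:: 5; 9]; [:: 5; 6; 2; 10]; [:: 5; 7; 3; 11]]];
    [:: [:: [:: 0; 9]; [:: 0; 10]; [:: 0; 11]];
       [:: [:: 1; 9]; [:: 1; 10]; [:: 1; 11]];
       [:: [:: 4; 9]; [:: 4; 6; 2; 10]; [:: 4; 7; 3; 11]]];
    [:: [:: [:: 0; 9]; [:: 0; 10]; [:: 0; 11]];
       [:: [:: 1; 9]; [:: 1; 10]; [:: 1; 11]];
       [:: [:: 2; 6; 4; 7; 5; 9]; [:: 2; 10]; [:: 2; 11]]]].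

Lemma doubled_hexagon_refuted : refuted doubled_hexagon.
Proof. by vm_compute. Qed.

(** Subdivisions inside the bipartite double of the 4-regular graph on pairs:
    3 a + b is adjacent to 9 + 3 c + d when a differs from c and b from d. *)
Definition nine_cover := [::
    [:: [:: [:: 5; 9]; [:: 5; 10]; [:: 5; 16; 2; 12]];
       [:: [:: 6; 11; 4; 9]; [:: 6; 10]; [:: 6; 14; 7; 12]];
       [:: [:: 8; 9]; [:: 8; 10]; [:: 8; 12]]];
    [:: [:: [:: 4; 11]; [:: 4; 9; 5; 16; 2; 12]; [:: 4; 15; 1; 14]];
       [:: [:: 6; 11]; [:: 6; 10; 8; 12]; [:: 6; 14]];
       [:: [:: 7; 11]; [:: 7; 12]; [:: 7; 14]]];
    [:: [:: [:: 4; 9]; [:: 4; 15; 1; 14; 6; 10]; [:: 4; 11; 7; 12]];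
       [:: [:: 5; 9]; [:: 5; 10]; [:: 5; 16; 2; 12]];
       [:: [:: 8; 9]; [:: 8; 10]; [:: 8; 12]]];
    [:: [:: [:: 4; 9]; [:: 4; 11]; [:: 4; 15; 1; 14]];
       [:: [:: 6; 10; 5; 9]; [:: 6; 11]; [:: 6; 14]];
       [:: [:: 7; 12; 8; 9]; [:: 7; 11]; [:: 7; 14]]]].

Lemma nine_cover_refuted : refuted nine_cover.
Proof. by vm_compute. Qed.

(** * Crossing parities of polygonal curves in the projective plane *)

(** The signs of the determinants of a generic family of vectors of a
    3-dimensional space; chi i j k means that the determinant is negative. The
    last field says that in a three-term Grassmann-Pluecker relation the terms
    do not all have the same sign. *)
Record chirotope (I : eqType) := Chirotope {
  chi :> I -> I -> I -> bool;
  chi_swap12 : forall i j k, uniq [:: i; j; k] -> chi j i k = ~~ chi i j k;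
  chi_swap23 : forall i j k, uniq [:: i; j; k] -> chi i k j = ~~ chi i j k;
  chi_plucker : forall a b c u v, uniq [:: a; b; c; u; v] ->
    ~~ ((chi u b c (+) chi u v a == chi a u c (+) chi u v b) &&
        (chi a u c (+) chi u v b == chi a b u (+) chi u v c)) }.

(** A point of the projective plane is an index together with a sign, that is,
    one of the two opposite lifts of the point. *)
Definition distinct (I : eqType) (s : seq (I * bool)) := uniq (map fst s).

Ltac distinct_from d := move: (d); rewrite /distinct /= ?inE ?negb_or ?andbT;
  repeat match goal with
  | |- is_true (_ && _) -> _ => case/andP
  | |- is_true _ -> _ => let H := fresh in move=> H
  end; repeat (apply/andP; split);
  first [done | assumption | rewrite eq_sym; assumption].

Section Crossings.
Variables (I : eqType) (C : chirotope I).
Implicit Types (a b c p q u v w x y z : I * bool) (s t : seq (I * bool)).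

Definition orient p q r := C p.1 q.1 r.1 (+) (p.2 (+) q.2 (+) r.2).

(** The segment from p to q is the cone spanned by these two lifts. Two such
    cones meet up to sign when each plane separates the two vectors of the
    other. *)
Definition cross p q u v := (orient p q u (+) orient p q v) && (orient u v p (+) orient u v q).

(** Whether u or its opposite lies in the cone of a, b and c. *)
Definition inside a b c u := (orient u b c == orient a u c) && (orient a u c == orient a b u).

Lemma orient_swap12 p q r : distinct [:: p; q; r] -> orient q p r = ~~ orient p q r.
Proof. by move=> d; rewrite /orient chi_swap12 //; case: (C _ _ _) p.2 q.2 r.2 => -[] [] []. Qed.

Lemma orient_swap23 p q r : distinct [:: p; q; r] -> orient p r q = ~~ orient p q r.
Proof. by move=> d; rewrite /orient chi_swap23 //; case: (C _ _ _) p.2 q.2 r.2 => -[] [] []. Qed.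

Lemma cross_sym p q u v : cross p q u v = cross u v p q.
Proof. exact: andbC. Qed.

Lemma cross_rev p q u v : distinct [:: p; q; u; v] -> cross q p u v = cross p q u v.
Proof.
move=> d; rewrite /cross (@orient_swap12 p q u) ?(@orient_swap12 p q v); try distinct_from d.
by rewrite addbN addNb negbK [orient u v q (+) _]addbC.
Qed.

(** A segment enters or leaves a triangle as often as its ends require. Only
    the signs matter: the two Grassmann-Pluecker relations exclude all other
    sign patterns. *)
Lemma triangle_cross a b c u v : distinct [:: a; b; c; u; v] ->
  cross a b u v (+) cross b c u v (+) cross c a u v =
  inside a b c u (+) inside a b c v.
Proof.
move=> d.
have cyc x y z : distinct [:: x; y; z] -> orient y z x = orient x y z.
  by move=> D; rewrite (@orient_swap23 y x z) ?(@orient_swap12 x y z) ?negbK //; distinct_from D.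
have plu x y : distinct [:: a; b; c; x; y] ->
    ~~ ((orient x b c (+) orient x y a == orient a x c (+) orient x y b) &&
        (orient a x c (+) orient x y b == orient a b x (+) orient x y c)).
  move=> dxy; have := chi_plucker C dxy; rewrite /orient.
  case: a.2; case: b.2; case: c.2; case: x.2; case: y.2 => //=;
  by rewrite ?addbF ?addbT ?addbN ?addNb ?negbK ?(inj_eq negb_inj).
have duv := plu u v d.
have dvu : ~~ ((orient v b c (+) orient u v a == orient a v c (+) orient u v b) &&
        (orient a v c (+) orient u v b == orient a b v (+) orient u v c)).
  have /plu : distinct [:: a; b; c; v; u] by distinct_from d.
  by rewrite 3?(@orient_swap12 u v) ?addbN ?(inj_eq negb_inj) //; distinct_from d.
rewrite /cross (cyc u b c) ?(cyc v b c) ?(cyc u c a) ?(cyc v c a) ?(cyc a u c)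
  ?(cyc a v c) /inside; try distinct_from d.
move: duv dvu.
move: (orient u v a) (orient u v b) (orient u v c) (orient u b c) (orient v b c)
  (orient a u c) (orient a v c) (orient a b u) (orient a b v).
by do 9![case].
Qed.

(** A polygonal curve is given by its first vertex x and the list s of the
    others. *)
Fixpoint seg_path_cross u v x s :=
  if s is y :: s' then cross x y u v (+) seg_path_cross u v y s' else false.

Fixpoint path_cross x s z t :=
  if t is w :: t' then seg_path_cross z w x s (+) path_cross x s w t' else false.

(** The parity of the number of triangles with apex q and base on the curve
    that contain the line of u. *)
Fixpoint fan_area q x s u :=
  if s is y :: s' then inside q x y u (+) fan_area q y s' u else false.

Lemma seg_path_cross_rev u v x s : distinct [:: u, v, x & s] ->
  seg_path_cross v u x s = seg_path_cross u v x s.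
Proof.
elim: s x => //= y s IH x d.
by rewrite IH 1?cross_sym 1?(@cross_rev u v x y) 1?cross_sym //; distinct_from d.
Qed.

Lemma distinct_sub s t : distinct t -> subseq s t -> distinct s.
Proof. by move=> dt st; apply: subseq_uniq dt; exact: map_subseq. Qed.

Lemma distinct_perm s t : perm_eq s t -> distinct s = distinct t.
Proof. by move=> st; apply: perm_uniq; exact: perm_map. Qed.

(** Sum of the triangle formula over the triangles with apex q. *)
Lemma fan q x s u v : distinct [:: q, u, v, x & s] ->
  seg_path_cross u v x s =
    cross q x u v (+) cross q (last x s) u v (+) (fan_area q x s u (+) fan_area q x s v).
Proof.
elim: s x => [|y s IH] x d /=; first by rewrite addbb.
rewrite IH; last by distinct_from d.
have := @triangle_cross q x y u v.
have dq : distinct [:: q; x; y; u; v]. by distinct_from d.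
move=> /(_ dq); rewrite (@cross_rev q y u v); last by distinct_from dq.
move=> E; have {E}-> : cross x y u v =
    cross q x u v (+) cross q y u v (+) (inside q x y u (+) inside q x y v).
  by rewrite -E; F2_ring.
by F2_ring.
Qed.

Lemma triangle_path a b c x s : distinct [:: a, b, c, x & s] ->
  seg_path_cross a b x s (+) seg_path_cross b c x s (+) seg_path_cross c a x s =
  inside a b c x (+) inside a b c (last x s).
Proof.
elim: s x => [|y s IH] x d /=; first by rewrite addbb.
have -> : inside a b c x = inside a b c y (+) (cross a b x y (+) cross b c x y (+) cross c a x y).
  by rewrite triangle_cross; [F2_ring | distinct_from d].
rewrite ![cross x y _ _]cross_sym.
have -> : inside a b c y = seg_path_cross a b y s (+) seg_path_cross b c y s (+)
    seg_path_cross c a y s (+) inside a b c (last y s).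
  by rewrite IH; [F2_ring | distinct_from d].
by F2_ring.
Qed.

Definition flip p : I * bool := (p.1, ~~ p.2).

(** Completing a segment by its complement gives a full projective line, and a
    curve meets a line as often as its lift changes sides. *)
Lemma line_path p b z t :
  seg_path_cross p b z t (+) seg_path_cross p (flip b) z t = orient p b z (+) orient p b (last z t).
Proof.
elim: t z => [|w t IH] z /=; first by rewrite addbb.
have -> : orient p b z (+) orient p b (last w t) =
    orient p b z (+) orient p b w (+) (orient p b w (+) orient p b (last w t)) by F2_ring.
rewrite -IH /cross.
have -> : orient z w (flip b) = ~~ orient z w b by rewrite /orient /= -!addbT; F2_ring.
have fE r : orient p (flip b) r = ~~ orient p b r by rewrite /orient /= -!addbT; F2_ring.
by rewrite !fE -!addbT; F2_ring.
Qed.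

Lemma inside_sign a b c p q : p.1 = q.1 -> inside a b c p = inside a b c q.
Proof.
move=> pq; rewrite /inside /orient pq.
by case: p.2; case: q.2; case: a.2; case: b.2; case: c.2; do 3?[case: (chi C _ _ _)].
Qed.

Lemma fan_area_sign q x s u v : u.1 = v.1 -> fan_area q x s u = fan_area q x s v.
Proof.
by move=> uv; elim: s x => //= y s IH x; rewrite IH (inside_sign _ _ _ uv).
Qed.

(** The crossings of two curves, reduced to those of the second one with the
    two segments that close up the first one through q. *)
Lemma fan_path q x s z t : distinct (q :: (x :: s) ++ z :: t) ->
  path_cross x s z t = seg_path_cross q x z t (+) seg_path_cross q (last x s) z t (+)
                    (fan_area q x s z (+) fan_area q x s (last z t)).
Proof.
elim: t z => [|w t IH] z d /=; first by rewrite addbb.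
rewrite IH; last first.
  apply: distinct_sub d _; rewrite -!cat_cons cat_subseq //.
  exact: subseq_cons.
rewrite (@fan q x s z w); first rewrite ![cross z w _ _]cross_sym; first by F2_ring.
have : distinct (q :: (x :: s) ++ [:: z; w]).
  apply: distinct_sub d _; rewrite -!cat_cons cat_subseq //= !eqxx;
    [exact: subseq_refl | exact: sub0seq].
rewrite (@distinct_perm _ [:: q, z, w, x & s]) //.
by rewrite perm_cons; exact: (permEl (perm_catC (x :: s) [:: z; w])).
Qed.

Variables (p p' : I * bool) (lift : I -> bool).

Definition vert (i : I) : I * bool := (i, lift i).

(** Compares the rays from the base point to i and j: whether they cross after
    the base point of the second one is moved to p', corrected by the triangle
    swept by this move. *)
Definition above (i j : I) :=
  inside (vert j) p p' (vert i) (+) cross p (vert i) (vert j) p'.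

(** A statement on four vectors. In the relation that expresses the third of
    them by the others the two lifts lie on the same side of the plane of p and
    p', and each possible sign pattern gives exactly one of the two
    comparisons. *)
Lemma above_antisym i j : distinct [:: p; p'; vert i; vert j] ->
  orient p p' (vert i) = orient p p' (vert j) -> above j i = ~~ above i j.
Proof.
move=> d; rewrite /above /cross /inside.
set P := vert i; set Q := vert j.
have cyc x y z : distinct [:: x; y; z] -> orient y z x = orient x y z.
  by move=> D; rewrite (@orient_swap23 y x z) ?(@orient_swap12 x y z) ?negbK //; distinct_from D.
have e1 x : distinct [:: p; p'; x] -> orient p x p' = ~~ orient p p' x.
  by move=> D; rewrite orient_swap23.
have e2 x : distinct [:: p; p'; x] -> orient x p p' = orient p p' x.
  by move=> D; rewrite -(cyc x p p') //; distinct_from D.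
have e3 x : distinct [:: p; p'; x] -> orient x p' p = ~~ orient p p' x.
  by move=> D; rewrite orient_swap23 ?e2 //; distinct_from D.
have d1 : distinct [:: p; p'; P] by distinct_from d.
have d2 : distinct [:: p; p'; Q] by distinct_from d.
rewrite ?e1 // ?e2 // ?e3 // => E.
have f1 : orient p Q P = ~~ orient p P Q by rewrite orient_swap23 //; distinct_from d.
have f2 : orient P Q p = orient p P Q by rewrite cyc //; distinct_from d.
have f3 : orient Q P p = ~~ orient p P Q by rewrite orient_swap12 ?f2 //; distinct_from d.
have f4 : orient Q p P = orient p P Q by rewrite (cyc P Q p) ?f2 //; distinct_from d.
have f5 : orient P p Q = ~~ orient p P Q by rewrite orient_swap12 //; distinct_from d.
have g2 : orient P Q p' = orient p' P Q by rewrite cyc //; distinct_from d.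
have g3 : orient Q P p' = ~~ orient p' P Q by rewrite orient_swap12 ?g2 //; distinct_from d.
have g4 : orient Q p' P = orient p' P Q by rewrite (cyc P Q p') ?g2 //; distinct_from d.
have g5 : orient P p' Q = ~~ orient p' P Q by rewrite orient_swap12 //; distinct_from d.
rewrite ?f1 ?f2 ?f3 ?f4 ?f5 ?g2 ?g3 ?g4 ?g5 ?E.
by case: (orient p P Q); case: (orient p' P Q); case: (orient p p' Q).
Qed.

Definition passes (e : (I * bool) * seq (I * bool)) (i : I) := seg_path_cross p (vert i) e.1 e.2.

(** Whether the lift of the path ends at the chosen lift of its last vertex, or
    at the opposite one. *)
Definition twist (e : (I * bool) * seq (I * bool)) : bool :=
  lift (last e.1 e.2).1 (+) (last e.1 e.2).2.

Lemma seg_path_cross_end x s z t : let b := last x s in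
  seg_path_cross p b z t = seg_path_cross p (vert b.1) z t (+)
    (twist (x, s) && (orient p (vert b.1) z (+) orient p (vert b.1) (last z t))).
Proof.
move=> b; rewrite -line_path /twist /= -/b.
case E : (lift b.1 (+) b.2) => /=.
  have -> : b = flip (vert b.1).
    by rewrite /flip /=; case: (b) E => i [] /=; case: (lift i).
  by rewrite addbA addbb.
rewrite addbF; suff -> : b = vert b.1 by [].
by rewrite /vert; case: (b) E => i [] /=; case: (lift i).
Qed.

Lemma orient_vert q r u : orient q r u = orient q r (vert u.1) (+) (lift u.1 (+) u.2).
Proof. by rewrite /orient /=; F2_ring. Qed.

(** The triangles of the fan that contain j are counted by the crossings of the
    curve with the ray to j, up to a term that does not depend on j. Moving the
    base point to p' is what makes the segments generic. *)
Lemma fan_area_passes x s j : distinct [:: p, p', vert j, x & s] -> x = vert x.1 ->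
  let b := (last x s).1 in
  fan_area p x s (vert j) (+) (twist (x, s) && orient p (vert b) (vert j)) =
  passes (x, s) j (+) (above x.1 j (+) above b j) (+)
  (seg_path_cross p p' x s (+) (twist (x, s) && orient p (vert b) p') (+) fan_area p x s p').
Proof.
move=> d xE b.
have dfan : distinct [:: p, vert j, p', x & s] by distinct_from d.
have := fan dfan; have := @seg_path_cross_end x s (vert j) [:: p'].
rewrite /= !addbF ![cross _ p' p _]cross_sym -/b => ->.
have dtri : distinct [:: vert j, p, p', x & s] by distinct_from d.
have := triangle_path dtri.
rewrite (inside_sign _ _ _ (erefl : (last x s).1 = (vert b).1)).
rewrite /passes /above -xE /=.
rewrite (@seg_path_cross_rev p (vert j)) ?(@seg_path_cross_rev (vert j) p'); try distinct_from d.
move=> e1 e2; have -> : inside (vert j) p p' x = seg_path_cross p (vert j) x s (+)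
    seg_path_cross p p' x s (+) seg_path_cross (vert j) p' x s (+) inside (vert j) p p' (vert b).
  by rewrite e1; F2_ring.
by rewrite e2; F2_ring.
Qed.
(** The equation of the crossing system for two disjoint curves: the fan
    formula expresses their zero crossings by the rays to the ends of the first
    curve and by the fan of the first curve, which is rewritten by the previous
    lemma. *)
Lemma path_equation x s z t : distinct ([:: p, p', x & s] ++ z :: t) ->
  x = vert x.1 -> z = vert z.1 -> ~~ path_cross x s z t ->
  let e := (x, s) in let f := (z, t) in
  let b := (last x s).1 in let d := (last z t).1 in
  twist e && twist f =
  passes f x.1 (+) passes f b (+) (passes e z.1 (+) passes e d) (+)
  (above x.1 z.1 (+) above x.1 d (+) (above b z.1 (+) above b d)).
Proof.
move=> D xE zE ncr e f b d.
have D1 j : j \in map fst (z :: t) -> distinct [:: p, p', vert j, x & s].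
  move: D; rewrite /distinct map_cat cat_uniq => /and3P[U /hasPn H _] /H.
  move: U; rewrite /= !inE !negb_or => /and3P[/andP[pp' /andP[px ps]] /andP[p'x p's] xs].
  case/and4P=> jp jp' jx js.
  by rewrite pp' px ps p'x p's jx js xs ![p.1 == j]eq_sym ![p'.1 == j]eq_sym jp jp'.
have zt : z.1 \in map fst (z :: t) by rewrite mem_head.
have dt : d \in map fst (z :: t) by rewrite map_f // mem_last.
have := fan_area_passes (D1 _ zt) xE; have := fan_area_passes (D1 _ dt) xE.
rewrite /= -/b -zE.
have Df : distinct (p :: (x :: s) ++ z :: t).
  by move: D; rewrite /distinct /= inE negb_or => /andP[/andP[_ ->] /andP[_ ->]].
have := fan_path Df; rewrite (negPf ncr).
rewrite (@seg_path_cross_end x s z t) -/b.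
rewrite (fan_area_sign _ _ _ (erefl : (last z t).1 = (vert d).1)).
have -> : orient p (vert b) (last z t) = orient p (vert b) (vert d) (+) twist f.
  by rewrite [LHS]orient_vert.
rewrite -/e [X in seg_path_cross p X z t]xE -![seg_path_cross p (vert _) z t]/(passes f _).
move=> e1 e2 e3.
have -> : twist e && twist f = passes f x.1 (+) passes f b (+)
    (fan_area p x s z (+) twist e && orient p (vert b) z (+)
     (fan_area p x s (vert d) (+) twist e && orient p (vert b) (vert d))).
  by rewrite -[LHS]addbF [X in _ (+) X = _]e1; F2_ring.
by rewrite e2 e3; F2_ring.
Qed.
End Crossings.

Local Open Scope ring_scope.

(** * Generic families of vectors *)

Section Geometry.
Variable K : realType.
Implicit Types (u v w : 'rV[K]_3).

Lemma dotE u v : dot u v = u 0 0 * v 0 0 + u 0 1 * v 0 1 + u 0 2 * v 0 2.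
Proof.
rewrite /dot !big_ord_recl big_ord0 addr0 addrA.
by congr (_ + _ * _ + _ * _); congr (_ _ _); apply/val_inj.
Qed.

Lemma dotZZ (x y : K) u v : dot (x *: u) (y *: v) = x * y * dot u v.
Proof. by rewrite !dotE !mxE; ring. Qed.

Lemma rV3_ext u v : u 0 0 = v 0 0 -> u 0 1 = v 0 1 -> u 0 2 = v 0 2 -> u = v.
Proof.
move=> e0 e1 e2; apply/rowP => -[[|[|[|//]]] i3].
- by rewrite (_ : Ordinal i3 = 0) //; apply/val_inj.
- by rewrite (_ : Ordinal i3 = 1) //; apply/val_inj.
- by rewrite (_ : Ordinal i3 = 2) //; apply/val_inj.
Qed.

Definition det3 u v w : K :=
  u 0 0 * (v 0 1 * w 0 2 - v 0 2 * w 0 1) -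
  u 0 1 * (v 0 0 * w 0 2 - v 0 2 * w 0 0) +
  u 0 2 * (v 0 0 * w 0 1 - v 0 1 * w 0 0).

(** Both sides are the cross product of the normals of the planes pq and uv. *)
Lemma det3_exchange (p q u v : 'rV[K]_3) :
  det3 u v q *: p - det3 u v p *: q = det3 p q u *: v - det3 p q v *: u.
Proof. by apply: rV3_ext; rewrite !mxE /det3; ring. Qed.

Definition generic (I : eqType) (g : I -> 'rV[K]_3) : Prop :=
  forall i j k, uniq [:: i; j; k] -> det3 (g i) (g j) (g k) != 0.

Section Chirotope.
Variables (I : eqType) (g : I -> 'rV[K]_3).
Hypothesis gen : generic g.

Lemma oppr_lt0_neg (x : K) : x != 0 -> (- x < 0) = ~~ (x < 0).
Proof. by move=> x0; rewrite oppr_lt0 -leNgt le_eqVlt eq_sym (negPf x0). Qed.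

Lemma addb_lt0 (x y : K) : x != 0 -> y != 0 -> (x < 0) (+) (y < 0) = (x * y < 0).
Proof.
move=> x0 y0.
case: (ltrgt0P x) x0 => // hx _; case: (ltrgt0P y) y0 => // hy _ /=; symmetry.
- by apply/negbTE; rewrite -leNgt mulr_ge0 ?ltW.
- by rewrite pmulr_rlt0.
- by rewrite nmulr_rlt0.
- by apply/negbTE; rewrite -leNgt ltW // nmulr_rgt0.
Qed.

Lemma chi3_swap12 i j k : uniq [:: i; j; k] ->
  (det3 (g j) (g i) (g k) < 0) = ~~ (det3 (g i) (g j) (g k) < 0).
Proof.
by move=> /gen d; rewrite -oppr_lt0_neg //; congr (_ < 0); rewrite /det3; ring.
Qed.

Lemma chi3_swap23 i j k : uniq [:: i; j; k] ->
  (det3 (g i) (g k) (g j) < 0) = ~~ (det3 (g i) (g j) (g k) < 0).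
Proof.
by move=> /gen d; rewrite -oppr_lt0_neg //; congr (_ < 0); rewrite /det3; ring.
Qed.

Lemma chi3_plucker (a b c u v : I) : uniq [:: a; b; c; u; v] ->
  let chi i j k := det3 (g i) (g j) (g k) < 0 in
  ~~ ((chi u b c (+) chi u v a == chi a u c (+) chi u v b) &&
      (chi a u c (+) chi u v b == chi a b u (+) chi u v c)).
Proof.
move=> U /=.
rewrite !addb_lt0; try by apply: gen; distinct_from U.
set x := _ * _; set y := _ * det3 _ _ (g b); set z := _ * det3 _ _ (g c).
have S : x + y + z = 0 by rewrite /x /y /z /det3; ring.
have x0 : x != 0.
  by rewrite mulf_neq0 //; apply: gen; distinct_from U.
apply/negP => /andP[/eqP xy /eqP yz].
case: (ltrgt0P x) x0 => // hx _.
  have : ~~ (y < 0) by rewrite -xy -leNgt ltW.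
  have : ~~ (z < 0) by rewrite -yz -xy -leNgt ltW.
  by rewrite -!leNgt => ? ?; lra.
have : y < 0 by rewrite -xy.
have : z < 0 by rewrite -yz -xy.
by move=> ? ?; lra.
Qed.

Definition generic_chirotope : chirotope I :=
  @Chirotope I (fun i j k => det3 (g i) (g j) (g k) < 0)
    chi3_swap12 chi3_swap23 chi3_plucker.

Definition signed_vec (p : I * bool) := (-1) ^+ p.2 *: g p.1.

Lemma det3_signed p q r :
  det3 (signed_vec p) (signed_vec q) (signed_vec r) =
  (-1) ^+ (p.2 (+) q.2 (+) r.2) * det3 (g p.1) (g q.1) (g r.1).
Proof.
by rewrite /det3 !mxE !signr_addb; ring.
Qed.

Lemma orientE p q r : distinct [:: p; q; r] ->
  orient generic_chirotope p q r = (det3 (signed_vec p) (signed_vec q) (signed_vec r) < 0).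
Proof.
move=> /gen; rewrite det3_signed /orient => d.
case: (p.2 (+) q.2 (+) r.2); last by rewrite expr0 mul1r addbF.
by rewrite expr1 mulN1r oppr_lt0_neg // addbT.
Qed.

Definition sqdist u v := dot (u - v) (u - v).

Lemma sqdistE u v : sqdist u v = dot u u + dot v v - 2 * dot v u.
Proof. by rewrite /sqdist !dotE !mxE; ring. Qed.

Lemma dot_ge0 u : 0 <= dot u u.
Proof. by rewrite dotE !addr_ge0 // -expr2 sqr_ge0. Qed.

Lemma sqdist_conv (a b : K) u v w e : 0 <= a -> 0 <= b -> a + b = 1 ->
  sqdist u w <= e -> sqdist v w <= e -> sqdist (a *: u + b *: v) w <= e.
Proof.
move=> a0 b0 ab ue ve; rewrite -[e]mul1r -ab mulrDl.
apply: le_trans (lerD (ler_wpM2l a0 ue) (ler_wpM2l b0 ve)).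
have -> : a = 1 - b by rewrite -ab; ring.
rewrite -subr_ge0 (_ : _ - _ = b * (1 - b) * dot (u - v) (u - v)).
  rewrite mulr_ge0 ?dot_ge0 // mulr_ge0 //; lra.
by rewrite /sqdist !dotE !mxE; ring.
Qed.

Lemma sqdist_triangle u v w : sqdist u w <= 2 * sqdist u v + 2 * sqdist v w.
Proof.
rewrite -subr_ge0 (_ : _ - _ = dot (u - v - (v - w)) (u - v - (v - w))) ?dot_ge0 //.
by rewrite /sqdist !dotE !mxE; ring.
Qed.

(** The coefficients come from the exchange formula; the sign conditions make
    those of p and q nonnegative, and those of u and v of the same sign. *)
Lemma cross_meet (p q u v : I * bool) : distinct [:: p; q; u; v] ->
  cross generic_chirotope p q u v ->
  exists a b c d : K, [/\ 0 <= a, 0 <= b, a + b = 1, 0 <= c * d &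
    a *: signed_vec p + b *: signed_vec q = c *: signed_vec u + d *: signed_vec v].
Proof.
move=> D /andP[]; rewrite !orientE; try by distinct_from D.
set d1 := det3 _ _ _; set d2 := det3 _ _ _; set e1 := det3 _ _ _; set e2 := det3 _ _ _.
have nz x y z : distinct [:: x; y; z] -> det3 (signed_vec x) (signed_vec y) (signed_vec z) != 0.
  by move=> /gen d0; rewrite det3_signed mulf_neq0 ?signr_eq0.
rewrite !addb_lt0 ?nz; try by distinct_from D.
move=> d12 e12; have ne : e2 - e1 != 0.
  by rewrite subr_eq0; apply/eqP => E; move: e12; rewrite E ltNge -expr2 sqr_ge0.
exists (e2 / (e2 - e1)), (- e1 / (e2 - e1)), (- d2 / (e2 - e1)), (d1 / (e2 - e1)).
have sq : 0 < (e2 - e1) ^+ 2 by rewrite lt_def sqrf_eq0 ne sqr_ge0.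
split.
- rewrite (_ : _ / _ = (e2 ^+ 2 - e1 * e2) / (e2 - e1) ^+ 2); last by field.
  by rewrite divr_ge0 ?sqr_ge0 // subr_ge0 (le_trans (ltW e12)) ?sqr_ge0.
- rewrite (_ : _ / _ = (e1 ^+ 2 - e1 * e2) / (e2 - e1) ^+ 2); last by field.
  by rewrite divr_ge0 ?sqr_ge0 // subr_ge0 (le_trans (ltW e12)) ?sqr_ge0.
- by field.
- rewrite [X in _ <= X](_ : _ = - (d1 * d2) / (e2 - e1) ^+ 2); last by field.
  by rewrite divr_ge0 ?sqr_ge0 // oppr_ge0 ltW.
rewrite ![_ / _]mulrC -!scalerA -!scalerDr; congr (_ *: _).
by rewrite !scaleNr det3_exchange addrC.
Qed.

(** Crossing segments would give a vector close to a and, up to scaling, close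
    to b. The line of b stays at squared distance at least d from a, which the
    factor 4 makes incompatible. *)
Lemma near_no_cross (p q u v : I * bool) (a b : 'rV[K]_3) (e d : K) :
  distinct [:: p; q; u; v] -> dot a a = 1 -> dot b b = 1 ->
  dot a b ^+ 2 <= 1 - d -> 4 * e < d ->
  sqdist (signed_vec p) a <= e -> sqdist (signed_vec q) a <= e ->
  sqdist (signed_vec u) b <= e -> sqdist (signed_vec v) b <= e ->
  ~~ cross generic_chirotope p q u v.
Proof.
move=> D a1 b1 abd ed pa qa ub vb; apply/negP => /(cross_meet D).
case=> [s [t [c [r [s0 t0 st cr E]]]]].
have W := sqdist_conv s0 t0 st pa qa; rewrite E in W.
pose w := c *: signed_vec u + r *: signed_vec v; rewrite -/w in W.
pose k := c + r.
have W' : sqdist w (k *: b) <= k ^+ 2 * e.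
  have [k0|k0] := eqVneq k 0.
    have c0 : c = 0.
      by apply/eqP; rewrite -sqrf_eq0 eq_le sqr_ge0 andbT; have := cr;
       rewrite (_ : r = - c) ?mulrN ?oppr_ge0 //; apply/eqP; rewrite -addr_eq0 addrC -/k k0.
    have r0 : r = 0 by move: k0; rewrite /k c0 add0r.
    rewrite /w k0 c0 r0 !scale0r addr0 expr2 !mul0r /sqdist subr0 dotE !mxE.
    by rewrite !mul0r !addr0.
  have kc : c / k + r / k = 1 by rewrite -mulrDl divff.
  have ksq : 0 < k ^+ 2 by rewrite lt_def sqrf_eq0 k0 sqr_ge0.
  have ck : 0 <= c / k.
    rewrite (_ : _ / _ = (c ^+ 2 + c * r) / k ^+ 2).
      by rewrite divr_ge0 ?sqr_ge0 // addr_ge0 ?sqr_ge0.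
    by rewrite /k in k0 *; field.
  have rk : 0 <= r / k.
    rewrite (_ : _ / _ = (r ^+ 2 + c * r) / k ^+ 2).
      by rewrite divr_ge0 ?sqr_ge0 // addr_ge0 ?sqr_ge0.
    by rewrite /k in k0 *; field.
  have := ler_wpM2l (ltW ksq) (sqdist_conv ck rk kc ub vb).
  apply: le_trans; rewrite le_eqVlt; apply/orP; left; apply/eqP.
  by rewrite /w /sqdist !dotE !mxE; rewrite /k in k0 *; field.
have T : sqdist a (k *: b) <= 2 * e + 2 * (k ^+ 2 * e).
  apply: le_trans (sqdist_triangle _ w _) _; rewrite lerD ?ler_wpM2l //.
  suff -> : sqdist a w = sqdist w a by [].
  by rewrite /sqdist !dotE !mxE; ring.
have L1 : d <= sqdist a (k *: b).
  have -> : sqdist a (k *: b) = 1 - dot a b ^+ 2 + (k - dot a b) ^+ 2.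
    transitivity (dot a a - 2 * k * dot a b + k ^+ 2 * dot b b).
      by rewrite /sqdist !dotE !mxE; ring.
    by rewrite a1 b1; ring.
  by have := sqr_ge0 (k - dot a b); lra.
have L2 : d * k ^+ 2 <= sqdist a (k *: b).
  have -> : sqdist a (k *: b) = (1 - dot a b ^+ 2) * k ^+ 2 + (1 - k * dot a b) ^+ 2.
    transitivity (dot a a - 2 * k * dot a b + k ^+ 2 * dot b b).
      by rewrite /sqdist !dotE !mxE; ring.
    by rewrite a1 b1; ring.
  have : d * k ^+ 2 <= (1 - dot a b ^+ 2) * k ^+ 2.
    by apply: ler_wpM2r; [exact: sqr_ge0 | lra].
  by have := sqr_ge0 (1 - k * dot a b); lra.
have := sqr_ge0 k; move: (k ^+ 2) T L2 => m T L2 m0.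
nra.
Qed.
End Chirotope.

(** Along the moment curve the determinant becomes a polynomial in s whose
    leading coefficient is a Vandermonde determinant. *)
Lemma det3_moment u v w (i j k : K) : i != j -> i != k -> j != k ->
  let m i : 'rV[K]_3 := \row_l i ^+ l in
  exists2 P : {poly K}, P != 0 & forall s,
    det3 (u + s *: m i) (v + s *: m j) (w + s *: m k) = P.[s].
Proof.
move=> ij ik jk m.
exists (Poly [:: det3 u v w; det3 (m i) v w + det3 u (m j) w + det3 u v (m k);
   det3 u (m j) (m k) + det3 (m i) v (m k) + det3 (m i) (m j) w; det3 (m i) (m j) (m k)]).
  apply/eqP => /(congr1 (fun P : {poly K} => P`_3)); rewrite coef_Poly coef0 /=.
  apply/eqP; rewrite (_ : det3 _ _ _ = (j - i) * (k - i) * (k - j)).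
    by rewrite !mulf_neq0 // subr_eq0 eq_sym.
  by rewrite /det3 !mxE /=; ring.
by move=> s; rewrite horner_Poly /= /det3 !mxE; ring.
Qed.

(** Move the vectors along distinct points of the moment curve; the finitely
    many polynomials have a common small non-root. *)
Lemma generic_perturbation (I : finType) (f : I -> 'rV[K]_3) (e : K) : 0 < e ->
  exists2 g : I -> 'rV[K]_3, generic g & forall i, sqdist (g i) (f i) <= e.
Proof.
move=> e0.
pose n (i : I) : K := (enum_rank i)%:R.
have n_inj i j : i != j -> n i != n j.
  by apply: contra; rewrite eqr_nat => /eqP/val_inj/enum_rank_inj->.
pose m (i : I) : 'rV[K]_3 := \row_l n i ^+ l.
have H (t : I * I * I) : exists P : {poly K}, P != 0 /\ (uniq [:: t.1.1; t.1.2; t.2] ->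
    forall s, det3 (f t.1.1 + s *: m t.1.1) (f t.1.2 + s *: m t.1.2) (f t.2 + s *: m t.2) = P.[s]).
  case: t => [[i j] k]; have [|nU] := boolP (uniq [:: i; j; k]); last first.
    by exists 1; split=> [|U]; [exact: oner_neq0 | by case/negP: nU].
  rewrite /= !inE negb_or andbT => /andP[/andP[ij ik] jk].
  have [P P0 PE] := det3_moment (f i) (f j) (f k) (n_inj _ _ ij) (n_inj _ _ ik) (n_inj _ _ jk).
  by exists P; split=> // _.
have [P PP] := choice H.
(* a common non-root of all the polynomials is a non-root of their product *)
pose Q := \prod_t P t.
have Q0 : Q != 0 by apply/prodf_neq0 => t _; have [] := PP t.
pose B : K := 1 + \sum_i dot (m i) (m i).
have B1 : 1 <= B by rewrite lerDl sumr_ge0 // => i _; exact: dot_ge0.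
have mB i : dot (m i) (m i) <= B.
  rewrite /B (bigD1 i) //= addrCA lerDl addr_ge0 // sumr_ge0 // => j _; exact: dot_ge0.
pose h : K := Num.min 1 (e / B).
have h0 : 0 < h by rewrite lt_min ltr01 divr_gt0 //; lra.
have [s [sh s0 Qs]] : exists s, [/\ s <= h, 0 <= s & Q.[s] != 0].
  (* more candidates than the degree of Q *)
  pose r := [seq h / k.+2%:R | k <- iota 0 (size Q)].
  have [/max_poly_roots|] := boolP (all (root Q) r).
    move=> /(_ Q0); rewrite size_map size_iota ltnn => F.
    suff /F : uniq r by [].
    rewrite map_inj_uniq ?iota_uniq // => k l kl.
    have /eqP : k.+2%:R = l.+2%:R :> K.
      by apply: invr_inj; apply: (mulfI (lt0r_neq0 h0)).
    by rewrite eqr_nat => /eqP[].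
  case/allPn => _ /mapP[k _ ->] Qk; exists (h / k.+2%:R); split=> //.
    by rewrite ler_pdivrMr // ler_peMr ?(ltW h0) // ler1n.
  by rewrite divr_ge0 ?(ltW h0).
exists (fun i => f i + s *: m i).
  move=> i j k U; have [_ /(_ U s)] := PP (i, j, k); rewrite /= => ->.
  by move: Qs; rewrite horner_prod => /prodf_neq0 /(_ (i, j, k) isT).
move=> i; have -> : sqdist (f i + s *: m i) (f i) = s ^+ 2 * dot (m i) (m i).
  by rewrite /sqdist !dotE !mxE; ring.
have hB : h * B <= e by rewrite -ler_pdivlMr ?ge_min ?lexx ?orbT //; lra.
have h1 : h <= 1 by rewrite ge_min lexx.
have s2 : s ^+ 2 <= s by rewrite expr2 ler_piMr //; exact: le_trans sh h1.
apply: le_trans hB; apply: ler_pM; rewrite ?sqr_ge0 ?dot_ge0 //.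
exact: le_trans s2 sh.
Qed.
End Geometry.

(** * Curves in the space of lines *)

Section Arcs.
Local Open Scope classical_set_scope.
Local Open Scope ring_scope.
Variable K : realType.

(** A continuous injection into the projective plane. The lift rho to unit
    vectors need not be continuous, but the products of its coordinates, which
    do not see the sign, are. *)
Definition line_chart (X : topologicalType) (rho : X -> 'rV[K]_3) : Prop :=
  [/\ forall P, dot (rho P) (rho P) = 1,
      forall i j, continuous (fun P => rho P 0 i * rho P 0 j)
    & forall P Q, dot (rho P) (rho Q) ^+ 2 = 1 -> P = Q].

Variables (X : topologicalType) (rho : X -> 'rV[K]_3).
Hypothesis chart : line_chart rho.

(** The squared cosine of the angle of two lines: close lines have a value
    close to 1. *)
Definition cosq P Q : K := dot (rho P) (rho Q) ^+ 2.

Lemma cosq_continuous (Y Z : topologicalType) (c : Y -> X) (d : Z -> X) :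
  continuous c -> continuous d ->
  continuous (fun st : Y * Z => cosq (c st.1) (d st.2)).
Proof.
case: chart => _ rho_cont _ cc cd.
have fc i j : continuous (fun st : Y * Z => rho (c st.1) 0 i * rho (c st.1) 0 j).
  move=> st; apply: (continuous_comp (f := c \o fst) (g := fun P => rho P 0 i * rho P 0 j)).
    by apply: continuous_comp; [exact: cvg_fst | exact: cc].
  exact: rho_cont.
have fd i j : continuous (fun st : Y * Z => rho (d st.2) 0 i * rho (d st.2) 0 j).
  move=> st; apply: (continuous_comp (f := d \o snd) (g := fun P => rho P 0 i * rho P 0 j)).
    by apply: continuous_comp; [exact: cvg_snd | exact: cd].
  exact: rho_cont.
have fcd i j : continuous (fun st : Y * Z => rho (c st.1) 0 i * rho (c st.1) 0 j *
     (rho (d st.2) 0 i * rho (d st.2) 0 j)).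
  by move=> st; apply: cvgM; [exact: fc | exact: fd].
have -> : (fun st : Y * Z => cosq (c st.1) (d st.2)) = (fun st =>
    \sum_(i < 3) \sum_(j < 3) rho (c st.1) 0 i * rho (c st.1) 0 j *
     (rho (d st.2) 0 i * rho (d st.2) 0 j)).
  apply/funext => st; rewrite /cosq expr2 /dot mulr_suml; apply: eq_bigr => i _.
  by rewrite mulr_sumr; apply: eq_bigr => j _; ring.
have sumC I (r : seq I) (h : I -> Y * Z -> K) : (forall i, continuous (h i)) ->
    continuous (fun st => \sum_(i <- r) h i st).
  move=> hC st; apply: (@cvg_big K I +%R 0 predT) => [x|i _]; last exact: hC.
  by apply: cvgD; [exact: cvg_fst | exact: cvg_snd].
by apply: (sumC) => i; apply: (sumC) => j.
Qed.

Lemma unit_square_compact : compact (`[0, 1]%classic `*` `[0, 1]%classic : set (K * K)).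
Proof. by apply: compact_setX; exact: segment_compact. Qed.

Lemma cosq_le1 P Q : cosq P Q <= 1.
Proof.
case: chart => rho1 _ _.
have -> : 1 = dot (rho P) (rho P) * dot (rho Q) (rho Q) by rewrite !rho1 mulr1.
rewrite /cosq !dotE; set u := rho P; set v := rho Q.
rewrite -subr_ge0 (_ : _ - _ = (u 0 0 * v 0 1 - u 0 1 * v 0 0) ^+ 2 +
  (u 0 0 * v 0 2 - u 0 2 * v 0 0) ^+ 2 + (u 0 1 * v 0 2 - u 0 2 * v 0 1) ^+ 2); last by ring.
by rewrite !addr_ge0 ?sqr_ge0.
Qed.

Lemma eventually_inv_le (e : K) : 0 < e -> exists n, forall m, (n <= m)%N -> m.+1%:R^-1 <= e.
Proof.
move=> e0; exists (Num.truncn e^-1) => m nm.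
rewrite -[e]invrK lef_pV2 ?posrE ?invr_gt0 //.
have /ltW := truncnS_gt e^-1; move/le_trans; apply; by rewrite ler_nat ltnS.
Qed.

Lemma arcs_separated (c d : K -> X) : continuous c -> continuous d ->
  (forall s t, s \in `[0, 1] -> t \in `[0, 1] -> c s <> d t) ->
  exists n, forall m, (n <= m)%N -> forall s t, s \in `[0, 1] -> t \in `[0, 1] ->
    cosq (c s) (d t) <= 1 - m.+1%:R^-1.
Proof.
move=> cc cd disj.
have ne : (`[0, 1]%classic `*` `[0, 1]%classic : set (K * K)) !=set0.
  by exists (0, 0); split=> /=; rewrite in_itv /= lexx ler01.
have [[s0 t0] st0 stP] := compact_EVT_max ne unit_square_compact
  (continuous_subspaceT (cosq_continuous cc cd)).
have [s01 t01] := set_mem st0.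
have lt1 : cosq (c s0) (d t0) < 1.
  rewrite lt_neqAle cosq_le1 andbT; apply/eqP => E.
  by case: chart => _ _ /(_ _ _ E); exact: (disj s0 t0 s01 t01).
have [n nP] : exists n, forall m, (n <= m)%N -> m.+1%:R^-1 <= 1 - cosq (c s0) (d t0).
  by apply: eventually_inv_le; rewrite subr_gt0.
exists n => m /nP nm s t s01' t01'.
have := stP (s, t); rewrite inE /= => /(_ (conj s01' t01')) => le.
by apply: (le_trans le); rewrite lerBrDr addrC -lerBrDr.
Qed.

(** Uniform continuity, obtained by minimising the distance of the parameters
    over the pairs of points that are not close. *)
Lemma arc_uniform (c : K -> X) (e : K) : continuous c -> 0 < e ->
  exists n, forall N k, (n <= N)%N -> (k < N)%N ->
    1 - e <= cosq (c (k%:R / N%:R)) (c (k.+1%:R / N%:R)).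
Proof.
move=> cc e0.
pose A : set (K * K) := (`[0, 1]%classic `*` `[0, 1]%classic) `&`
  [set st | cosq (c st.1) (c st.2) <= 1 - e].
have cA : compact A.
  apply: (subclosed_compact _ unit_square_compact); last by move=> x [].
  apply: closedI.
    by apply: compact_closed; [exact: norm_hausdorff | exact: unit_square_compact].
  apply: (closed_comp (f := fun st : K * K => cosq (c st.1) (c st.2)) (D := [set x | x <= 1 - e])).
    by move=> x _; exact: cosq_continuous.
  exact: closed_le.
have in01 k N : (k <= N)%N -> (0 < N)%N -> k%:R / N%:R \in `[0, 1 : K].
  move=> kN N0; rewrite in_itv /= divr_ge0 //= ler_pdivrMr ?ltr0n // mul1r ler_nat //.
have [A0|A0] := pselect (A !=set0); last first.
  exists 1 => N k N0 kN; rewrite leNgt; apply/negP => lt1.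
  apply: A0; exists (k%:R / N%:R, k.+1%:R / N%:R); split=> /=; last exact: ltW.
  by split; apply: in01 => //; exact: ltnW.
have distC : continuous (fun st : K * K => `|st.1 - st.2|).
  move=> st; apply: (continuous_comp (f := fun st : K * K => st.1 - st.2)).
    by apply: cvgB; [exact: cvg_fst | exact: cvg_snd].
  exact: norm_continuous.
have [[s0 t0] st0 stP] := compact_EVT_min A0 cA (continuous_subspaceT distC).
have [_ /= st0e] := set_mem st0.
have m0 : 0 < `|s0 - t0|.
  rewrite normr_gt0 subr_eq0; apply/eqP => E; move: st0e.
  by case: chart => rho1 _ _; rewrite E /cosq rho1 expr1n; lra.
have [n nP] := eventually_inv_le (divr_gt0 m0 (ltr0n K 2)).
exists n.+1 => N k nN kN; rewrite leNgt; apply/negP => lt1.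
have N0 : (0 < N)%N by exact: leq_ltn_trans kN.
have := stP (k%:R / N%:R, k.+1%:R / N%:R); rewrite inE => /(_ _) /= le.
have {}le : `|s0 - t0| <= `|k%:R / N%:R - k.+1%:R / N%:R|.
  apply: le; split=> /=; last exact: ltW.
  by split; apply: in01 => //; exact: ltnW.
have {}le : `|s0 - t0| <= N%:R^-1.
  apply: le_trans le _; rewrite distrC -mulrBl -natrB // subSnn mul1r ger0_norm //.
have := nP N.-1; rewrite -ltnS prednK // => /(_ nN); lra.
Qed.
End Arcs.

(** * Polygonal approximation of a drawing *)

Lemma eventually_forall (T : finType) (P : T -> nat -> Prop) :
  (forall t, exists n, forall m, (n <= m)%N -> P t m) ->
  exists n, forall t m, (n <= m)%N -> P t m.
Proof.
move=> /choice[f fP]; exists (\max_t f t)%N => t m le; apply: fP.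
by apply: leq_trans le; exact: (leq_bigmax t).
Qed.

Lemma last_map_iota (T : Type) (h : nat -> T) m n :
  last (h m) (map h (iota m.+1 n)) = h (m + n)%N.
Proof. by elim: n m => [|n IH] m /=; rewrite ?addn0 // IH addSnnS. Qed.

Section Sampling.
Local Open Scope classical_set_scope.
Local Open Scope ring_scope.
Variables (K : realType) (G : sgraph) (X : topologicalType).
Variables (rho : X -> 'rV[K]_3) (chart : line_chart rho).
Variables (pt : G -> X) (arc : G -> G -> K -> X).
Hypothesis emb : embedding pt arc.

(** Extends an arc by constants to the whole line, through a formula whose
    continuity is immediate. *)
Definition clamp (t : K) : K := (`|t| - `|t - 1| + 1) / 2.

Lemma clamp_continuous : continuous clamp.
Proof.
move=> t; apply: cvgM; last exact: cvg_cst.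
apply: cvgD; last exact: cvg_cst.
apply: cvgB; first exact: norm_continuous.
apply: (continuous_comp (f := fun t : K => t - 1)); last exact: norm_continuous.
by apply: cvgB; [exact: cvg_id | exact: cvg_cst].
Qed.

Lemma clamp_itv t : clamp t \in `[0, 1].
Proof.
rewrite in_itv /= /clamp.
by case: (ger0P t) => ?; case: (ger0P (t - 1)) => ?;
  apply/andP; split; lra.
Qed.

Lemma clamp_id t : t \in `[0, 1] -> clamp t = t.
Proof.
rewrite in_itv /= /clamp => /andP[t0 t1].
by rewrite ger0_norm // ler0_norm ?subr_le0 //; field.
Qed.

Lemma clamped_arc_continuous a b : adj a b -> continuous (arc a b \o clamp).
Proof.
move=> ab t; have /subspace_continuousP ac := arc_continuous emb ab.
apply: cvg_trans (ac (clamp t) (clamp_itv t)).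
move=> U /= WU; have := clamp_continuous WU.
by apply: (@filterS _ (nbhs t)) => s /=; apply; exact: clamp_itv.
Qed.

(** Closed arcs of edges without common end, by cases on whether the parameters
    are at the ends. *)
Lemma arcs_disjoint a b c d : adj a b -> adj c d -> uniq [:: a; b; c; d] ->
  forall s t, s \in `[0, 1] -> t \in `[0, 1] -> arc a b s <> arc c d t.
Proof.
move=> ab cd; rewrite /= !inE !negb_or !andbT.
case/and3P=> /and3P[nab nac nad] /andP[nbc nbd] ncd s t s01 t01 E.
have ends (r : K) : r \in `[0, 1] -> [\/ r = 0, r = 1 | r \in `]0, 1[].
  rewrite !in_itv /= => /andP[]; rewrite le_eqVlt => /predU1P[<-|r0]; first by constructor 1.
  by rewrite le_eqVlt => /predU1P[->|r1]; [constructor 2 | constructor 3; rewrite r0].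
have vE x y : x != y -> pt x <> pt y by move=> /eqP xy /(pt_inj emb).
case: (ends s s01) => sE; case: (ends t t01) => tE; move: E;
  rewrite ?sE ?tE ?(arc_start emb) ?(arc_end emb) //; try exact: vE.
- by move=> /esym; exact: (arc_vertex emb cd tE).
- by move=> /esym; exact: (arc_vertex emb cd tE).
- exact: (arc_vertex emb ab sE).
- exact: (arc_vertex emb ab sE).
case/(arc_disjoint emb ab cd sE tE) => -[E1 E2].
  by rewrite E1 eqxx in nac.
by rewrite E1 eqxx in nbc.
Qed.

Section Path.
Variables (N : nat) (e d : K).
Hypotheses (N0 : (0 < N)%N) (d0 : 0 < d) (ed : e = d / 64).

Let idx_type : finType := (bool + (G + G * G * 'I_N.+1))%type.

(** The first two points are the auxiliary base points, placed anywhere;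
    generic perturbation separates them. The others are the vertices and the
    interior subdivision points of each edge. *)
Definition sample (i : idx_type) : 'rV[K]_3 :=
  match i with
  | inl _ => 0
  | inr (inl v) => rho (pt v)
  | inr (inr (a, b, k)) => rho (arc a b (k%:R / N%:R))
  end.

Definition node a b k : idx_type :=
  if k == 0%N then inr (inl a) else if k == N then inr (inl b)
  else inr (inr (a, b, inord k)).

Lemma sample_node a b k : adj a b -> (k <= N)%N ->
  sample (node a b k) = rho (arc a b (k%:R / N%:R)).
Proof.
move=> ab kN; rewrite /node; case: eqP => [->|_] /=.
  by rewrite mul0r (arc_start emb).
case: eqP => [->|_] /=; first by rewrite divff ?pnatr_eq0 -?lt0n // (arc_end emb).
by rewrite inordK.
Qed.

Lemma node_uniq a b c d' : uniq [:: a; b; c; d'] ->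
  uniq ([:: inl false; inl true] ++ map (node a b) (iota 0 N.+1) ++
        map (node c d') (iota 0 N.+1)).
Proof.
move=> U.
have inj v w : v != w -> {in iota 0 N.+1 &, injective (node v w)}.
  move=> vw k l; rewrite !mem_iota !add0n /= !ltnS /node => kN lN.
  case: (eqVneq k 0%N) => k0; case: (eqVneq l 0%N) => l0;
  case: (eqVneq k N) => kN'; case: (eqVneq l N) => lN' // E;
  first [by rewrite ?k0 ?kN' ?l0 ?lN' | by case: E vw => ->; rewrite eqxx | idtac].
  by case: E => /(congr1 val); rewrite /= !inordK // ltnS.
have [nab ncd] : a != b /\ c != d' by split; distinct_from U.
have [nac nad nbc nbd] : [/\ a != c, a != d', b != c & b != d'] by split; distinct_from U.
rewrite cat_uniq; apply/and3P; split; first by [].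
  apply/hasPn => i; rewrite mem_cat => /orP[] /mapP[k _ ->];
  by rewrite /node; case: eqP => // _; case: eqP.
rewrite cat_uniq !map_inj_in_uniq ?iota_uniq; try exact: inj.
rewrite andbT; apply/hasPn => i /mapP[k _ ->]; apply/negP => /mapP[l _].
rewrite /node; do 4?[case: eqP => _] => -[] // E;
  by rewrite ?E ?eqxx in nac nad nbc nbd.
Qed.

Variable gv : idx_type -> 'rV[K]_3.
Hypotheses (gen : generic gv) (near_sample : forall i, sqdist (gv i) (sample i) <= e).
Hypothesis dense : forall a b k, adj a b -> (k < N)%N ->
  1 - e <= cosq rho (arc a b (k%:R / N%:R)) (arc a b (k.+1%:R / N%:R)).
Hypothesis apart : forall a b c d', adj a b -> adj c d' -> uniq [:: a; b; c; d'] ->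
  forall s t, s \in `[0, 1] -> t \in `[0, 1] ->
  cosq rho (arc a b s) (arc c d' t) <= 1 - d.

Let C := generic_chirotope gen.
Let p : idx_type * bool := (inl false, false).
Let p' : idx_type * bool := (inl true, false).
Let lift (i : idx_type) : bool := C (inl false) (inl true) i.

(** The lifts along the path: consecutive ones are chosen at an acute
    angle. *)
Fixpoint sheet a b k : bool :=
  if k is k'.+1 then
    sheet a b k' (+)
    (dot (rho (arc a b (k'%:R / N%:R))) (rho (arc a b (k'.+1%:R / N%:R))) < 0)
  else lift (inr (inl a)).

Definition point a b k := (node a b k, sheet a b k).

Definition center a b k : 'rV[K]_3 :=
  (-1) ^+ sheet a b k *: rho (arc a b (k%:R / N%:R)).

Lemma center1 a b k : dot (center a b k) (center a b k) = 1.
Proof. by case: chart => rho1 _ _; rewrite dotZZ rho1 mulr1 -expr2 sqrr_sign. Qed.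

Lemma vec_near a b k : adj a b -> (k <= N)%N ->
  sqdist (signed_vec gv (point a b k)) (center a b k) <= e.
Proof.
move=> ab kN; rewrite /signed_vec /center /= -(sample_node ab kN) /sqdist -scalerBr dotZZ.
by rewrite -expr2 sqrr_sign mul1r; exact: near_sample.
Qed.

(** The squared distance of two unit vectors at angle t is 2 - 2 cos t, and cos
    t is at least its square. *)
Lemma vec_near_next a b k : adj a b -> (k < N)%N ->
  sqdist (signed_vec gv (point a b k.+1)) (center a b k) <= 6 * e.
Proof.
move=> ab kN; apply: le_trans (sqdist_triangle _ (center a b k.+1) _) _.
have n1 := vec_near ab kN.
suff : sqdist (center a b k.+1) (center a b k) <= 2 * e by lra.
have -> : sqdist (center a b k.+1) (center a b k) = 2 - 2 * dot (center a b k) (center a b k.+1).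
  by rewrite sqdistE !center1; ring.
have := dense ab kN; rewrite /cosq.
have -> : dot (center a b k) (center a b k.+1) =
  `|dot (rho (arc a b (k%:R / N%:R))) (rho (arc a b (k.+1%:R / N%:R)))|.
  rewrite dotZZ -signr_addb /= addKb mulr_sign.
  by case: ltrP => hx; rewrite ?(ltr0_norm hx) ?(ger0_norm hx).
set x := dot _ _ => xe.
have x1 : `|x| <= 1.
  have := cosq_le1 chart (arc a b (k%:R / N%:R)) (arc a b (k.+1%:R / N%:R)).
  by rewrite /cosq -/x -[x ^+ 2]real_normK ?num_real // expr_le1.
have : x ^+ 2 <= `|x|.
  by rewrite -[x ^+ 2]real_normK ?num_real // expr2 ler_piMr.
by move=> ?; lra.
Qed.

Lemma frac_itv k : (k <= N)%N -> k%:R / N%:R \in `[0, 1 : K].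
Proof.
move=> kN; rewrite in_itv /= divr_ge0 //= ler_pdivrMr ?ltr0n // mul1r ler_nat //.
Qed.

Lemma no_cross a b c d' k l : adj a b -> adj c d' -> uniq [:: a; b; c; d'] ->
  (k < N)%N -> (l < N)%N ->
  ~~ cross C (point a b k) (point a b k.+1) (point c d' l) (point c d' l.+1).
Proof.
move=> ab cd U kN lN.
have de : d = 64 * e by rewrite ed; field.
have e0 : 0 < e by rewrite ed divr_gt0.
apply: (@near_no_cross K _ gv gen _ _ _ _ (center a b k) (center c d' l) (6 * e) d).
- have := node_uniq U; rewrite /distinct; apply: subseq_uniq.
  rewrite -[map fst _]/([::] ++ ([:: node a b k; node a b k.+1] ++
    [:: node c d' l; node c d' l.+1])).
  apply: cat_subseq; first exact: sub0seq.
  have sub v w j : (j < N)%N ->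
      subseq [:: node v w j; node v w j.+1] (map (node v w) (iota 0 N.+1)).
    move=> jN; rewrite -[[:: _; _]]/(map (node v w) (iota j 2)); apply: map_subseq.
    have -> : N.+1 = (j + (2 + (N.-1 - j)))%N by lia.
    rewrite iotaD add0n iotaD; apply: subseq_trans (suffix_subseq _ _).
    exact: prefix_subseq.
  by apply: cat_subseq; exact: sub.
- exact: center1.
- exact: center1.
- rewrite dotZZ !exprMn !sqrr_sign !mul1r.
  by apply: apart => //; apply: frac_itv; exact: ltnW.
- by rewrite de; lra.
- by apply: le_trans (vec_near ab (ltnW kN)) _; lra.
- exact: vec_near_next.
- by apply: le_trans (vec_near cd (ltnW lN)) _; lra.
- exact: vec_near_next.
Qed.

Definition lifted_path a b := (point a b 0, map (point a b) (iota 1 N)).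

Lemma path_cross_map (h h' : nat -> idx_type * bool) m n m' n' :
  (forall k l, (m <= k < m + n)%N -> (m' <= l < m' + n')%N ->
    ~~ cross C (h k) (h k.+1) (h' l) (h' l.+1)) ->
  ~~ path_cross C (h m) (map h (iota m.+1 n)) (h' m') (map h' (iota m'.+1 n')).
Proof.
elim: n' m' => //= n' IH m' H.
have -> : seg_path_cross C (h' m') (h' m'.+1) (h m) (map h (iota m.+1 n)) = false.
  have {}H k : (m <= k < m + n)%N -> ~~ cross C (h k) (h k.+1) (h' m') (h' m'.+1).
    by move=> km; apply: H => //; lia.
  elim: n m H {IH} => //= n IHn m H.
  rewrite (negPf (H _ _)); last by lia.
  by rewrite IHn // => k km; apply: H; lia.
by apply: IH => k l km lm; apply: H => //; lia.
Qed.

(** The vertices are lifted to the positive side of the plane of the two base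
    points, as the comparison of rays requires. *)
Lemma sampled_system : crosscap_system (@adj G).
Proof.
exists (fun a b => twist lift (lifted_path a b)).
exists (fun a b v => passes C p lift (lifted_path a b) (inr (inl v))).
exists (fun v w => above C p p' lift (inr (inl v)) (inr (inl w))).
have liftE i : orient C p p' (vert lift i) = false.
  by rewrite /orient /= /lift addbb.
split=> [v w vw|a b c d' ab cd U].
  rewrite above_antisym ?liftE // /distinct /= !inE /= andbT.
  by apply: contra vw => /eqP[->].
have lastE v w : last (point v w 0) (map (point v w) (iota 1 N)) = point v w N.
  exact: last_map_iota.
have nodeN v w : node v w N = inr (inl w) by rewrite /node eqxx eqn0Ngt N0.
have node0 v w : node v w 0 = inr (inl v) by [].
have := @path_equation _ C p p' lift (point a b 0) (map (point a b) (iota 1 N))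
  (point c d' 0) (map (point c d') (iota 1 N)).
rewrite !lastE ![(point _ _ _).1]/= !nodeN => ->.
- by rewrite !node0 [X in X (+) _ = _]addbC.
- by rewrite /distinct map_cat !map_cons -!map_comp; exact: node_uniq U.
- by [].
- by [].
by apply: path_cross_map => k l; rewrite !add0n => /= kN lN; exact: no_cross.
Qed.
End Path.
End Sampling.

(** The constants: independent arcs have squared cosine at most 1 - d, and
    e = d / 64 leaves room in 4 (6 e) < d for the perturbation and for one step
    along an edge. *)
Theorem line_chart_crosscap_system (K : realType) (G : sgraph) (X : topologicalType)
    (rho : X -> 'rV[K]_3) :
  line_chart rho -> embeddable K G X -> crosscap_system (@adj G).
Proof.
move=> chart [pt [arc emb]].
have [n0 apart] : exists n, forall (q : G * G * G * G) m, (n <= m)%N ->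
    let: (a, b, c, d) := q in adj a b -> adj c d -> uniq [:: a; b; c; d] ->
    forall s t : K, s \in `[0, 1] -> t \in `[0, 1] ->
    cosq rho (arc a b s) (arc c d t) <= 1 - m.+1%:R^-1.
  apply: eventually_forall => -[[[a b] c] d].
  have [ab|nab] := boolP (adj a b); last by exists 0%N.
  have [cd|ncd] := boolP (adj c d); last by exists 0%N.
  have [U|nU] := boolP (uniq [:: a; b; c; d]); last by exists 0%N.
  have dis s t : s \in `[0, 1] -> t \in `[0, 1] ->
      (arc a b \o clamp (K := K)) s <> (arc c d \o clamp (K := K)) t.
    by move=> s01 t01; apply: (arcs_disjoint emb ab cd U); exact: clamp_itv.
  have [n nP] := arcs_separated chart (clamped_arc_continuous emb ab)
    (clamped_arc_continuous emb cd) dis.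
  exists n => m nm _ _ _ s t s01 t01; have := nP m nm s t s01 t01.
  by rewrite /= !clamp_id.
pose d : K := n0.+1%:R^-1; pose e : K := d / 64.
have d0 : 0 < d by rewrite invr_gt0.
have e0 : 0 < e by rewrite divr_gt0.
have [n1 dense] : exists n, forall (q : G * G) N, (n <= N)%N -> adj q.1 q.2 ->
    forall k, (k < N)%N -> 1 - e <= cosq rho (arc q.1 q.2 (k%:R / N%:R))
       (arc q.1 q.2 (k.+1%:R / N%:R)).
  apply: eventually_forall => -[a b].
  have [ab|nab] := boolP (adj a b); last by exists 0%N.
  have [n nP] := arc_uniform chart (clamped_arc_continuous emb ab) e0.
  exists n => N nN _ k kN; have := nP N k nN kN.
  have N0 : (0 < N)%N by exact: leq_ltn_trans kN.
  by rewrite /= !clamp_id ?(frac_itv _ N0) // ltnW.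
pose N := n1.+1.
have [gv gen near_s] := generic_perturbation (sample rho pt arc (N := N)) e0.
apply: (@sampled_system K G X rho chart pt arc emb N e d _ d0 _ gv gen) => //.
- by move=> a b k ab kN; exact: (dense (a, b) N (leqnSn _) ab k kN).
- by move=> a b c d' ab cd U s t; exact: (apart (a, b, c, d') n0 (leqnn _) ab cd U).
Qed.

(** * The sphere with one crosscap as a space of lines *)

Section Chart.
Local Open Scope classical_set_scope.
Local Open Scope ring_scope.
Local Open Scope quotient_scope.
Variables (K : realType) (C : caps K 1).
Local Notation Y := (set_type (punctured_sphere C)).
Local Notation Q := (quotient_topology {eq_quot crosscap_rel C}).
Let c := cap_center C ord0.
Let h := cap_height C ord0.

(** The boundary circle of the cap is centred at the point h c inside the
    sphere, and opposite points of the circle have opposite rays from it. *)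
Definition ray (x : Y) : 'rV[K]_3 := val x - h *: c.

Lemma dot0_eq (u : 'rV[K]_3) : dot u u = 0 -> u = 0.
Proof.
move=> /eqP; rewrite dotE -!expr2 !paddr_eq0 ?addr_ge0 ?sqr_ge0 // !sqrf_eq0.
by case/andP=> /andP[/eqP u0 /eqP u1] /eqP u2; apply: rV3_ext; rewrite !mxE.
Qed.

Lemma punctureP (x : Y) : dot (val x) (val x) = 1 /\ dot (val x) c <= h.
Proof. by have [x1 xh] := set_mem (valP x); split=> //; exact: (xh ord0). Qed.

Lemma height_sq : h ^+ 2 < 1.
Proof. by have /andP[h1 h2] : -1 < h < 1 := cap_height_bound C ord0; nra. Qed.

(** The equation of the sphere in polar coordinates around the point h c. *)
Lemma ray_expand x : dot (ray x) (ray x) + 2 * h * dot (ray x) c + h ^+ 2 = 1.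
Proof.
have [x1 _] := punctureP x; have c1 := cap_center_sphere C ord0.
transitivity (dot (val x) (val x) - h ^+ 2 * dot c c + h ^+ 2).
  by rewrite /ray !dotE !mxE; ring.
by rewrite x1 c1 mulr1 subrK.
Qed.

Lemma ray_below x : dot (ray x) c <= 0.
Proof.
have [_ xh] := punctureP x; have c1 := cap_center_sphere C ord0.
have -> : dot (ray x) c = dot (val x) c - h * dot c c.
  by rewrite /ray !dotE !mxE; ring.
by rewrite c1 mulr1 subr_le0.
Qed.

Lemma ray_neq0 x : dot (ray x) (ray x) != 0.
Proof.
apply/eqP => r0; have := ray_expand x; rewrite r0 (dot0_eq r0) dotE !mxE.
by have := height_sq; lra.
Qed.

Lemma ray_gt0 x : 0 < dot (ray x) (ray x).
Proof. by rewrite lt_def ray_neq0 dot_ge0. Qed.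

Lemma glue_ray x y : crosscap_glue x y -> ray y = ray x \/ ray y = - ray x.
Proof.
case/orP=> [/eqP->|/existsP[i /andP[_ /eqP yE]]]; first by left.
right; rewrite /ray yE (ord1 i) -/c -/h mulr_natl mulr2n scalerDl.
by rewrite opprB; apply: rV3_ext; rewrite !mxE; ring.
Qed.

(** A line through h c meets the sphere in two points on opposite sides of the
    plane of the circle, unless it lies in this plane. So two points of the
    punctured sphere on the same line are equal, or opposite on the circle. *)
Lemma ray_glue x y : dot (ray x) (ray y) ^+ 2 = dot (ray x) (ray x) * dot (ray y) (ray y) ->
  crosscap_glue x y.
Proof.
move=> E; pose l := dot (ray x) (ray y) / dot (ray x) (ray x).
have rE : ray y = l *: ray x.
  apply/eqP; rewrite -subr_eq0; apply/eqP/dot0_eq.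
  transitivity (dot (ray y) (ray y) - dot (ray x) (ray y) ^+ 2 / dot (ray x) (ray x)).
    have -> : dot (ray y - l *: ray x) (ray y - l *: ray x) =
      dot (ray y) (ray y) - 2 * l * dot (ray x) (ray y) + l ^+ 2 * dot (ray x) (ray x).
      by rewrite !dotE !mxE; ring.
    by rewrite /l; field; exact: ray_neq0.
  by rewrite E mulrAC mulfV ?ray_neq0 // mul1r subrr.
have := ray_expand x; have := ray_expand y; have := ray_below y; have := ray_below x.
have := ray_gt0 x; have hsq := height_sq; rewrite rE.
have -> : dot (l *: ray x) c = l * dot (ray x) c by rewrite !dotE !mxE; ring.
have -> : dot (l *: ray x) (l *: ray x) = l ^+ 2 * dot (ray x) (ray x).
  by rewrite !dotE !mxE; ring.
move: (dot (ray x) (ray x)) (erefl (dot (ray x) c)).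
move: {2 3 4 5 6}(dot (ray x) c) => q n qE n0 q0 lq0 ey ex.
have : (l - 1) * (n * (l + 1) + 2 * h * q) = 0 by lra.
move/eqP; rewrite mulf_eq0 => /orP[|/eqP E2].
  rewrite subr_eq0 => /eqP l1; apply/orP; left; apply/eqP/val_inj.
  by apply: (addIr (- (h *: c))); rewrite -/(ray y) -/(ray x) rE l1 scale1r.
have hl : h ^+ 2 - n * l = 1 by rewrite -ex; lra.
have l0 : l < 0.
  rewrite ltNge; apply/negP => l0; have : 0 <= n * l by rewrite mulr_ge0 // ltW.
  lra.
have qz : q = 0 by apply: le_anti; rewrite q0 /=; nra.
have l1 : l = -1.
  move: E2; rewrite qz mulr0 addr0 => /eqP; rewrite mulf_eq0 (gt_eqF n0) /=.
  by rewrite addr_eq0 => /eqP.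
apply/orP; right; apply/existsP; exists ord0; rewrite -/c -/h; apply/andP; split.
  have c1 := cap_center_sphere C ord0.
  rewrite -subr_eq0 -[X in _ - X]mulr1 -c1 -/c; apply/eqP.
  by rewrite -qz -qE /ray !dotE !mxE; ring.
apply/eqP; have : val y = ray y + h *: c by rewrite /ray subrK.
move=> ->; rewrite rE l1 scaleN1r /ray.
by apply: rV3_ext; rewrite !mxE; ring.
Qed.

Definition line (P : Q) : 'rV[K]_3 :=
  (Num.sqrt (dot (ray (repr P)) (ray (repr P))))^-1 *: ray (repr P).

Lemma line_dot P R : dot (line P) (line R) ^+ 2 =
  dot (ray (repr P)) (ray (repr R)) ^+ 2 /
  (dot (ray (repr P)) (ray (repr P)) * dot (ray (repr R)) (ray (repr R))).
Proof.
by rewrite /line dotZZ exprMn exprMn !exprVn !sqr_sqrtr ?dot_ge0 // mulrC -invfM.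
Qed.

Lemma ray_coord_continuous (i : 'I_3) : continuous (fun x : Y => ray x 0 i).
Proof.
rewrite (_ : (fun x => _) = (fun x : Y => val x 0 i - (h *: c) 0 i)); last first.
  by apply/funext => z; rewrite /ray !mxE.
move=> x; apply: (cvgB (F := nbhs x)); last exact: cvg_cst.
apply: (continuous_comp (f := (val : Y -> 'rV[K]_3)) (g := fun M : 'rV[K]_3 => M 0 i)).
  exact: initial_continuous.
exact: coord_continuous.
Qed.

Lemma crosscap_line_chart : line_chart line.
Proof.
split.
- move=> P; rewrite /line dotZZ -expr2 exprVn sqr_sqrtr ?dot_ge0 // mulVf //.
  exact: ray_neq0.
- move=> i j.
  pose g (x : Y) := ray x 0 i * ray x 0 j / dot (ray x) (ray x).
  have -> : (fun P => line P 0 i * line P 0 j) = g \o (repr : Q -> Y).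
    apply/funext => P; rewrite /g /line /=; move: (ray (repr P)) => u.
    rewrite !mxE mulrACA -expr2 exprVn sqr_sqrtr ?dot_ge0 //.
    by rewrite mulrC.
  apply: repr_comp_continuous.
    move=> x; apply: (cvgM (F := nbhs x)).
      by apply: (cvgM (F := nbhs x)); exact: ray_coord_continuous.
    apply: (cvgV (F := nbhs x)); first exact: ray_neq0.
    have dE : (fun x : Y => dot (ray x) (ray x)) =
      (fun x => ray x 0 0 * ray x 0 0 + ray x 0 1 * ray x 0 1 + ray x 0 2 * ray x 0 2).
      by apply/funext => z; rewrite dotE.
    rewrite dotE dE; apply: (cvgD (F := nbhs x)).
      by apply: (cvgD (F := nbhs x)); apply: (cvgM (F := nbhs x)); exact: ray_coord_continuous.
    by apply: (cvgM (F := nbhs x)); exact: ray_coord_continuous.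
  move=> x y /eqP xy.
  have /eqP : x = y %[mod {eq_quot crosscap_rel C}] by exact: xy.
  rewrite eqmodE => /glue_ray[] E; first by rewrite /g E.
  rewrite /g E.
  by rewrite !mxE mulrNN; apply/eqP; congr (_ / _); rewrite !dotE !mxE; ring.
move=> P R; rewrite line_dot => E.
have glued : crosscap_glue (repr P) (repr R); last first.
  have PR : repr P = repr R %[mod {eq_quot crosscap_rel C}] by apply/eqP; rewrite eqmodE.
  by rewrite -[P]reprK -[R]reprK; exact: PR.
apply: ray_glue.
have := congr1 (fun z => z * (dot (ray (repr P)) (ray (repr P)) *
  dot (ray (repr R)) (ray (repr R)))) E.
by rewrite mul1r mulfVK // mulf_neq0 // ray_neq0.
Qed.
End Chart.

Corollary crosscap_embeddable_system (K : realType) (G : sgraph) :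
  crosscap_embeddable K G 1 -> crosscap_system (@adj G).
Proof. by case=> C; apply: line_chart_crosscap_system; exact: crosscap_line_chart. Qed.

(** * Straight-line drawings *)

Section Stereographic.
Local Open Scope classical_set_scope.
Local Open Scope ring_scope.
Local Open Scope quotient_scope.
Variables (K : realType) (C : caps K 0).
Local Notation Y := (set_type (punctured_sphere C)).

(** Inverse stereographic projection, written as a combination of basis vectors
    so that continuity is that of its coefficients. *)
Definition stereo (P : K * K) : 'rV[K]_3 :=
  let s := P.1 ^+ 2 + P.2 ^+ 2 + 1 in
  (2 * P.1 / s) *: delta_mx 0 0 + (2 * P.2 / s) *: delta_mx 0 1 +
  (1 - 2 / s) *: delta_mx 0 2.

Lemma stereo_den (P : K * K) : P.1 ^+ 2 + P.2 ^+ 2 + 1 != 0.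
Proof. by apply: lt0r_neq0; rewrite ltr_wpDl // addr_ge0 ?sqr_ge0. Qed.

Lemma stereoE P : let s := P.1 ^+ 2 + P.2 ^+ 2 + 1 in
  [/\ stereo P 0 0 = 2 * P.1 / s, stereo P 0 1 = 2 * P.2 / s & stereo P 0 2 = 1 - 2 / s].
Proof.
by split; rewrite /stereo !mxE /= ?mulr1 ?mulr0 ?addr0 ?add0r.
Qed.

Lemma stereo_sphere P : punctured_sphere C (stereo P).
Proof.
split; last by case.
have [e0 e1 e2] := stereoE P; rewrite dotE e0 e1 e2; field; exact: stereo_den.
Qed.

Definition stereoY P : Y := exist _ (stereo P) (mem_set (stereo_sphere P)).

Lemma stereo_inj : injective stereo.
Proof.
move=> P R E.
have [p0 p1 p2] := stereoE P; have [r0 r1 r2] := stereoE R.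
have inv P' : (P'.1 = stereo P' 0 0 / (1 - stereo P' 0 2)) /\
   (P'.2 = stereo P' 0 1 / (1 - stereo P' 0 2)).
  have [-> -> ->] := stereoE P'.
  by split; field; rewrite stereo_den /= ?subKr ?mulf_neq0 ?invr_neq0 ?stereo_den ?pnatr_eq0.
have [a b] := inv P; have [c d] := inv R.
by rewrite [P]surjective_pairing [R]surjective_pairing a b c d E.
Qed.

Definition plane_point P : crosscap_sphere C := \pi_({eq_quot crosscap_rel C}) (stereoY P).

Lemma plane_point_inj : injective plane_point.
Proof.
move=> P R E; have /eqP : stereoY P = stereoY R %[mod {eq_quot crosscap_rel C}] by exact: E.
rewrite eqmodE => /orP[/eqP /(congr1 val) /stereo_inj //|].
by case/existsP=> -[].
Qed.

Lemma plane_point_continuous (x y : K -> K) : continuous x -> continuous y ->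
  continuous (fun t => plane_point (x t, y t)).
Proof.
move=> cx cy t.
apply: (continuous_comp (f := fun t => stereoY (x t, y t))
  (g := \pi_(quotient_topology {eq_quot crosscap_rel C}))); last exact: pi_continuous.
apply: continuous_comp_initial => {t} t.
have cs : continuous (fun t => (x t ^+ 2 + y t ^+ 2 + 1)^-1).
  move=> u; apply: (cvgV (F := nbhs u)); first exact: (stereo_den (x u, y u)).
  apply: (cvgD (F := nbhs u)); last exact: cvg_cst.
  by apply: (cvgD (F := nbhs u)); rewrite expr2; apply: (cvgM (F := nbhs u));
    (exact: cx || exact: cy).
apply: (cvgD (F := nbhs t)); first apply: (cvgD (F := nbhs t)).
- apply: cvgZr_tmp; apply: (cvgM (F := nbhs t)); last exact: cs.
  by apply: (cvgM (F := nbhs t)); [exact: cvg_cst | exact: cx].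
- apply: cvgZr_tmp; apply: (cvgM (F := nbhs t)); last exact: cs.
  by apply: (cvgM (F := nbhs t)); [exact: cvg_cst | exact: cy].
apply: cvgZr_tmp; apply: (cvgB (F := nbhs t)); first exact: cvg_cst.
by apply: (cvgM (F := nbhs t)); [exact: cvg_cst | exact: cs].
Qed.
End Stereographic.

Definition signed_area (K : pzRingType) (A B C : K * K) : K :=
  (B.1 - A.1) * (C.2 - A.2) - (B.2 - A.2) * (C.1 - A.1).

(** No vertex lies on the line of an edge to which it does not belong, and
    edges without common end are separated by the line of one of them.
    Horizontally the drawing fits in an interval of length 9, so that
    translates by 10 are disjoint. *)
Definition straight_line_ok (T : seq (int * int)) (e : rel nat) : bool :=
  let I := iota 0 (size T) in let P := nth (0, 0) T in
  [&& uniq T, all (fun A => 0 <= A.1 <= 9) T,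
      all (fun a => all (fun b => e a b ==> (a != b) &&
        all (fun c => (c == a) || (c == b) || (signed_area (P a) (P b) (P c) != 0)) I) I) I
    & all (fun a => all (fun b => e a b ==>
        all (fun c => all (fun d => e c d && uniq [:: a; b; c; d] ==>
          (0 < signed_area (P a) (P b) (P c) * signed_area (P a) (P b) (P d)) ||
          (0 < signed_area (P c) (P d) (P a) * signed_area (P c) (P d) (P b))) I) I) I) I].

Section StraightLine.
Local Open Scope classical_set_scope.
Local Open Scope ring_scope.
Local Open Scope quotient_scope.
Variables (K : realType) (G : sgraph).
Variables (T : seq (int * int)) (e : rel nat) (comp pos : G -> nat).
Hypotheses (ok : straight_line_ok T e) (pos_lt : forall v, (pos v < size T)%N).
Hypothesis label_inj : injective (fun v => (comp v, pos v)).
Hypothesis adj_label : forall v w, adj v w -> comp v = comp w /\ e (pos v) (pos w).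

Let P := nth (0, 0) T.

(** Components are drawn side by side, in copies of the same drawing. *)
Definition place (v : G) : K * K :=
  ((10 * comp v)%N%:R + (P (pos v)).1%:~R, (P (pos v)).2%:~R).

Definition segment (v w : G) (t : K) : K * K :=
  ((1 - t) * (place v).1 + t * (place w).1, (1 - t) * (place v).2 + t * (place w).2).

Lemma pair_ext (A B : K * K) : A.1 = B.1 -> A.2 = B.2 -> A = B.
Proof. by case: A B => ? ? [? ?] /= -> ->. Qed.

Lemma signed_area_place u v w : comp u = comp v -> comp v = comp w ->
  signed_area (place u) (place v) (place w) = (signed_area (P (pos u)) (P (pos v)) (P (pos w)))%:~R.
Proof.
by move=> uv vw; rewrite /signed_area /place /= uv vw !rmorphB /= !rmorphM /= !rmorphB /=; ring.
Qed.

Lemma signed_area_segment (A B : K * K) u v t :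
  signed_area A B (segment u v t) =
    (1 - t) * signed_area A B (place u) + t * signed_area A B (place v).
Proof. by rewrite /signed_area /segment /=; ring. Qed.

Lemma signed_area_on_line u v t : signed_area (place u) (place v) (segment u v t) = 0.
Proof. by rewrite /signed_area /segment /=; ring. Qed.

Lemma same_side_neq0 (t x y : K) : 0 < t -> t < 1 -> 0 < x * y -> (1 - t) * x + t * y <> 0.
Proof.
move=> t0 t1 xy E; have : 0 < ((1 - t) * x + t * y) * x.
  have xx : 0 <= x * x by rewrite -expr2 sqr_ge0.
  rewrite mulrDl -!mulrA [y * x]mulrC; apply: ltr_wpDl.
    by rewrite mulr_ge0 ?subr_ge0 ?(ltW t1).
  by rewrite mulr_gt0.
by rewrite E mul0r ltxx.
Qed.

Lemma signed_area_same (A B : K * K) : signed_area A B A = 0 /\ signed_area A B B = 0.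
Proof. by split; rewrite /signed_area; ring. Qed.

Lemma place_box v : (10 * comp v)%N%:R <= (place v).1 <= (10 * comp v)%N%:R + 9.
Proof.
have /and4P[_ /allP box _ _] := ok.
have /box/andP[l h] : P (pos v) \in T by exact: mem_nth.
by rewrite /place /= lerDl ler0z l lerD2l /= -[9]/(9%:~R) ler_int.
Qed.

Lemma segment_comp u v u' v' s t : comp u = comp v -> comp u' = comp v' ->
  s \in `[0, 1] -> t \in `[0, 1] -> segment u v s = segment u' v' t -> comp u = comp u'.
Proof.
have box w w' r : comp w = comp w' -> r \in `[0, 1] ->
    (10 * comp w)%N%:R <= (segment w w' r).1 <= (10 * comp w)%N%:R + 9.
  move=> ww rI; have /andP[r0 r1] : 0 <= r <= 1 by move: rI; rewrite in_itv.
  have /andP[a b] := place_box w; have /andP[c d] := place_box w'.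
  rewrite -ww in c d; rewrite -[(segment w w' r).1]/((1 - r) * (place w).1 + r * (place w').1).
  move: a b c d.
  move: (place w).1 (place w').1 (10 * comp w)%N%:R => x y L a b c d.
  apply/andP; split; rewrite -subr_ge0.
    rewrite [X in 0 <= X](_ : _ = (1 - r) * (x - L) + r * (y - L)); last by ring.
    by rewrite addr_ge0 // mulr_ge0 ?subr_ge0.
  rewrite [X in 0 <= X](_ : _ = (1 - r) * (L + 9 - x) + r * (L + 9 - y)); last by ring.
  by rewrite addr_ge0 // mulr_ge0 ?subr_ge0.
move=> uv uv' s01 t01 E; have := box _ _ _ uv s01; have := box _ _ _ uv' t01.
rewrite E => /andP[a b] /andP[c d].
have : ((10 * comp u)%N%:R <= (10 * comp u' + 9)%N%:R :> K) by rewrite natrD; lra.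
have : ((10 * comp u')%N%:R <= (10 * comp u + 9)%N%:R :> K) by rewrite natrD; lra.
rewrite !ler_nat; lia.
Qed.

Lemma place_inj : injective place.
Proof.
have /and4P[uT _ _ _] := ok.
have segE w : segment w w 0 = place w.
  by rewrite /segment subr0 !mul1r !mul0r !addr0 -surjective_pairing.
move=> v w E; apply: label_inj.
have cvw : comp v = comp w.
  apply: (@segment_comp v v w w 0 0) => //; rewrite ?in_itv /= ?lexx ?ler01 //.
  by rewrite !segE.
congr (_, _) => //; apply/eqP; rewrite -(nth_uniq (0, 0) (pos_lt v) (pos_lt w) uT) -/P.
move: E; rewrite /place cvw => -[/addrI/intr_inj E1 /intr_inj E2].
by rewrite [P (pos v)]surjective_pairing E1 E2 -surjective_pairing.
Qed.

Lemma off_line u v w : adj u v -> comp w = comp u -> w != u -> w != v ->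
  signed_area (place u) (place v) (place w) != 0.
Proof.
move=> uv wu nwu nwv; have [cuv euv] := adj_label uv.
rewrite signed_area_place -?cuv // intr_eq0.
have /and4P[_ _ /allP line _] := ok.
have I x : pos x \in iota 0 (size T) by rewrite mem_iota add0n /=.
have /allP/(_ _ (I v)) := line _ (I u); rewrite euv /= => /andP[_ /allP/(_ _ (I w))].
have ne x : w != x -> comp w = comp x -> pos w != pos x.
  by move=> /eqP wx cwx; apply/eqP => pwx; apply: wx; apply: label_inj; rewrite /= cwx pwx.
by rewrite (negPf (ne u nwu wu)) (negPf (ne v nwv (etrans wu cuv))).
Qed.

(** A common point of two segments lies on both lines. The oriented area is
    affine along a segment, so it would have to vanish at a point where its
    values at the two ends have the same sign, or only one of them is zero. *)
Lemma straight_line_embedding (C : caps K 0) :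
  embedding (fun v => plane_point C (place v)) (fun u v t => plane_point C (segment u v t)).
Proof.
have neq (u v : G) : adj u v -> u != v.
  by apply: contraTneq => ->; rewrite adj_irr.
have seg0 u v : segment u v 0 = place u.
  by rewrite /segment subr0 !mul1r !mul0r !addr0 -surjective_pairing.
have seg1 u v : segment u v 1 = place v.
  by rewrite /segment subrr !mul1r !mul0r !add0r -surjective_pairing.
have itvW (t : K) : t \in `]0, 1[ -> t \in `[0, 1].
  by rewrite !in_itv /= => /andP[/ltW -> /ltW ->].
have off u v w t : adj u v -> t \in `]0, 1[ -> segment u v t <> place w.
  move=> uv t01 E; have [cuv _] := adj_label uv.
  have cuw : comp u = comp w.
    apply: (@segment_comp u v w w t 0) => //; first exact: itvW.
      by rewrite in_itv /= lexx ler01.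
    by rewrite seg0.
  have [t0 t1] : 0 < t /\ t < 1 by move: t01; rewrite in_itv /= => /andP[].
  have ends : ~ (w = u \/ w = v).
    have nuv := neq _ _ uv.
    have key (x y : K) : (1 - t) * x + t * y = x -> x = y.
      by move=> H; apply: (mulfI (lt0r_neq0 t0)); lra.
    have key' (x y : K) : (1 - t) * x + t * y = y -> x = y.
      move=> H; have t' : 1 - t != 0 by rewrite subr_eq0 gt_eqF.
      by apply: (mulfI t'); lra.
    case=> ww; case/eqP: nuv; apply: place_inj; apply: pair_ext; rewrite ww in E.
    - by apply: key; exact: (congr1 fst E).
    - by apply: key; exact: (congr1 snd E).
    - by apply: key'; exact: (congr1 fst E).
    - by apply: key'; exact: (congr1 snd E).
  have nwu : w != u by apply/eqP => ?; apply: ends; left.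
  have nwv : w != v by apply/eqP => ?; apply: ends; right.
  by have := off_line uv (esym cuw) nwu nwv; rewrite -E signed_area_on_line eqxx.
have disj u v u' v' s t : adj u v -> adj u' v' -> s \in `]0, 1[ -> t \in `]0, 1[ ->
    segment u v s = segment u' v' t -> (u' = u /\ v' = v) \/ (u' = v /\ v' = u).
  move=> uv uv' s01 t01 E; have [cuv euv] := adj_label uv; have [cuv' euv'] := adj_label uv'.
  have cuu : comp u = comp u' by apply: (segment_comp cuv cuv' (itvW _ s01) (itvW _ t01) E).
  have [s0 s1] : 0 < s /\ s < 1 by move: s01; rewrite in_itv /= => /andP[].
  have [t0 t1] : 0 < t /\ t < 1 by move: t01; rewrite in_itv /= => /andP[].
  have o1 : (1 - t) * signed_area (place u) (place v) (place u') +
            t * signed_area (place u) (place v) (place v') = 0.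
    by rewrite -signed_area_segment -E signed_area_on_line.
  have o2 : (1 - s) * signed_area (place u') (place v') (place u) +
            s * signed_area (place u') (place v') (place v) = 0.
    by rewrite -signed_area_segment E signed_area_on_line.
  have ou' := @off_line u v u' uv (esym cuu).
  have ov' := @off_line u v v' uv (esym (etrans cuu cuv')).
  have [oA oB] := signed_area_same (place u) (place v).
  have nuv' := neq _ _ uv'.
  have [E1|N1] := eqVneq u' u.
    have [E2|N2] := eqVneq v' v; first by left.
    exfalso; move: o1 nuv'; rewrite E1 oA mulr0 add0r => /eqP.
    rewrite mulf_eq0 (gt_eqF t0) /= => o1 nuv'; have := ov' _ N2.
    by rewrite o1 => /(_ _)/negP; apply; rewrite // eq_sym.
  have [E1|N1'] := eqVneq u' v.
    have [E2|N2] := eqVneq v' u; first by right.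
    exfalso; move: o1 nuv'; rewrite E1 oB mulr0 add0r => /eqP.
    rewrite mulf_eq0 (gt_eqF t0) /= => o1 nuv'; have := ov' N2.
    by rewrite o1 => /(_ _)/negP; apply; rewrite // eq_sym.
  exfalso; have [E2|N2] := eqVneq v' u.
    move: o1; rewrite E2 oA mulr0 addr0 => /eqP; rewrite mulf_eq0 subr_eq0 (gt_eqF t1) /=.
    by apply/negP; exact: ou'.
  have [E2|N2'] := eqVneq v' v.
    move: o1; rewrite E2 oB mulr0 addr0 => /eqP; rewrite mulf_eq0 subr_eq0 (gt_eqF t1) /=.
    by apply/negP; exact: ou'.
  have /and4P[_ _ _ /allP cross] := ok.
  have I x : pos x \in iota 0 (size T) by rewrite mem_iota add0n /=.
  have /allP/(_ _ (I v)) := cross _ (I u); rewrite euv /= => /allP/(_ _ (I u'))/allP/(_ _ (I v')).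
  have ne x y : x != y -> comp x = comp y -> pos x != pos y.
    by move=> /eqP xy cxy; apply/eqP => pxy; apply: xy; apply: label_inj; rewrite /= cxy pxy.
  have U : uniq [:: pos u; pos v; pos u'; pos v'].
    have c1 : comp v = comp u by [].
    have c2 : comp v' = comp u by rewrite -cuv'.
    have nuv := neq _ _ uv.
    rewrite eq_sym in N1; rewrite eq_sym in N1'; rewrite eq_sym in N2; rewrite eq_sym in N2'.
    by rewrite /= !inE !negb_or (ne u v) ?(ne u u') ?(ne u v') ?(ne v u') ?(ne v v')
      ?(ne u' v') ?c1 ?c2.
  rewrite euv' /=; move: U => /= ->; rewrite /= => /orP[] H.
    have {}H : 0 < signed_area (place u) (place v) (place u') *
        signed_area (place u) (place v) (place v').
      by rewrite !signed_area_place -?cuv -?cuu -?cuv' // -intrM ltr0z.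
    exact: (same_side_neq0 t0 t1 H o1).
  have {}H : 0 < signed_area (place u') (place v') (place u) *
      signed_area (place u') (place v') (place v).
    by rewrite !signed_area_place -?cuv -?cuv' -?cuu // -intrM ltr0z.
  exact: (same_side_neq0 s0 s1 H o2).
split.
- by move=> u v /plane_point_inj/place_inj.
- move=> u v uv; apply: continuous_subspaceT; apply: plane_point_continuous => t;
  (apply: (cvgD (F := nbhs t)); apply: (cvgM (F := nbhs t)); try exact: cvg_cst; try exact: cvg_id);
  by apply: (cvgB (F := nbhs t)); [exact: cvg_cst | exact: cvg_id].
- move=> u v uv s t _ _ /plane_point_inj E.
  have E1 : (1 - s) * (place u).1 + s * (place v).1 =
    (1 - t) * (place u).1 + t * (place v).1 := congr1 fst E.
  have E2 : (1 - s) * (place u).2 + s * (place v).2 =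
    (1 - t) * (place u).2 + t * (place v).2 := congr1 snd E.
  apply/eqP; rewrite -subr_eq0.
  apply: contraTT (neq _ _ uv) => st; rewrite negbK; apply/eqP/place_inj.
  by apply: pair_ext; apply: (mulfI st); lra.
- by move=> u v _; rewrite seg0.
- by move=> u v _; rewrite seg1.
- by move=> u v _ t _; congr (plane_point _ _); rewrite /segment; congr (_, _); ring.
- by move=> u v w uv t t01 /plane_point_inj; exact: off.
- by move=> u v u' v' uv uv' s t s01 t01 /plane_point_inj; exact: disj.
Qed.

Lemma straight_line_planar : crosscap_embeddable K G 0.
Proof.
have [C] := caps_exist K 0; exists C.
by exists (fun v => plane_point C (place v)), (fun u v t => plane_point C (segment u v t));
  exact: straight_line_embedding.
Qed.
End StraightLine.

(** * Atoms and the radical of a finite ring *)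

Lemma exists_in_notin (T : finType) (A : {pred T}) (s : seq T) :
  (size s < #|A|)%N -> exists2 x, x \in A & x \notin s.
Proof.
move=> lt_s; apply/exists_inP; apply: contraTT lt_s.
rewrite negb_exists_in -leqNgt => /forall_inP all_s.
rewrite cardE; apply: uniq_leq_size (enum_uniq _) _ => x.
by rewrite mem_enum => /all_s; rewrite negbK.
Qed.

Lemma uniq_exhausts (T : finType) (A : {pred T}) (s : seq T) :
  uniq s -> {subset s <= A} -> (#|A| <= size s)%N -> {subset A <= s}.
Proof.
move=> us sA cA x xA.
have sub : {subset s <= enum A} by move=> y /sA; rewrite mem_enum.
have [|_ ->] := uniq_min_size us sub; first by rewrite -cardE.
by rewrite mem_enum.
Qed.

Section FiniteRing.
Variable R : finComUnitRingType.
Implicit Types (e f x y z : R).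

(** The Jacobson radical, which is also the nilradical here. *)
Definition radical : {set R} := [set j : R | [forall r : R, 1 + r * j \is a GRing.unit]].

Lemma radicalP j : reflect (forall r, 1 + r * j \is a GRing.unit) (j \in radical).
Proof. by rewrite inE; apply: forallP. Qed.

Lemma radicalMl r j : j \in radical -> r * j \in radical.
Proof. by move=> /radicalP J; apply/radicalP => s; rewrite mulrA. Qed.

Lemma radical0 : 0 \in radical.
Proof. by apply/radicalP => r; rewrite mulr0 addr0 unitr1. Qed.

Lemma unit_addJ u j : u \is a GRing.unit -> j \in radical -> u + j \is a GRing.unit.
Proof.
move=> uu /radicalP/(_ u^-1) U.
have : u * (1 + u^-1 * j) \is a GRing.unit by rewrite unitrM uu U.
by rewrite mulrDr mulr1 mulVKr.
Qed.

Lemma radicalD i j : i \in radical -> j \in radical -> i + j \in radical.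
Proof.
move=> I J; apply/radicalP => r; rewrite mulrDr addrA.
by apply: unit_addJ; [exact/radicalP | exact: radicalMl].
Qed.

Lemma radicalN j : j \in radical -> - j \in radical.
Proof. by move=> /(radicalMl (-1)); rewrite mulN1r. Qed.

Lemma radical1F : (1 \in radical) = false.
Proof.
apply/negP => /radicalP/(_ (-1)); rewrite mulr1 subrr unitr0 //.
Qed.

Lemma radical_unit u : u \is a GRing.unit -> (u \in radical) = false.
Proof.
by move=> uu; apply/negP => /(radicalMl u^-1); rewrite mulVr // radical1F.
Qed.

(** Geometric series. *)
Lemma nilpotent_radical x n : x ^+ n = 0 -> x \in radical.
Proof.
move=> xn; apply/radicalP => r.
pose y := - r * x; have yn : y ^+ n = 0 by rewrite exprMn xn mulr0.
have := subrX1 y n; rewrite yn sub0r => /(congr1 -%R); rewrite opprK -mulNr opprB => E.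
have -> : 1 + r * x = 1 - y by rewrite /y mulNr opprK.
by apply/unitrP; exists (\sum_(i < n) y ^+ i); rewrite mulrC -E.
Qed.

Definition idempotent e := e * e == e.

Lemma idempotent_compl e : idempotent e -> idempotent (1 - e).
Proof. by move=> /eqP ee; apply/eqP; rewrite mulrBl mul1r mulrBr mulr1 ee subrr subr0. Qed.

Lemma idempotent_radical e : idempotent e -> e \in radical -> e = 0.
Proof.
move=> /eqP ee /radicalP/(_ (-1)); rewrite mulN1r => u.
by apply: (mulrI u); rewrite mulrBl mul1r ee subrr mulr0.
Qed.

(** The powers of x are eventually periodic; take an exponent that is a
    multiple of the period and lies beyond the preperiod. *)
Lemma idempotent_power x : exists2 n, (0 < n)%N & idempotent (x ^+ n).
Proof.
have [i [j [ij E]]] : exists i j, (i < j)%N /\ x ^+ i = x ^+ j.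
  have /injectivePn[i [j ij E]] : ~~ injectiveb (fun i : 'I_#|R|.+1 => x ^+ i).
    apply/negP => /injectiveP /leq_card; rewrite card_ord ltnn //.
  have [lt|lt|eq] := ltngtP i j; first by exists i, j.
    by exists j, i.
  by move: ij; rewrite (val_inj eq) eqxx.
have per k m : (i <= k)%N -> x ^+ (k + m * (j - i)) = x ^+ k.
  move=> ik; elim: m => [|m IH]; first by rewrite mul0n addn0.
  rewrite mulSn addnCA.
  have -> : (j - i + (k + m * (j - i)) = j + (k - i + m * (j - i)))%N by lia.
  rewrite exprD -E -exprD.
  have -> : (i + (k - i + m * (j - i)) = k + m * (j - i))%N by lia.
  by rewrite IH.
exists (i.+1 * (j - i))%N; first by rewrite muln_gt0 /= subn_gt0.
apply/eqP; rewrite -exprD; apply: per.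
by rewrite (leq_trans (leqnSn i)) // leq_pmulr // subn_gt0.
Qed.

Lemma minimal_idempotent (P : R -> Prop) e0 : idempotent e0 -> P e0 ->
  exists e, [/\ idempotent e, P e &
    forall f, idempotent f -> P f -> e * f = f -> f = e].
Proof.
have [n] := ubnP #|[set e0 * x | x : R]|; elim: n e0 => // n IH e0 lt_n id0 P0.
have [[f [idf Pf ef nf]]|no] := pselect (exists f,
    [/\ idempotent f, P f, e0 * f = f & f <> e0]).
  apply: (IH f) => //; rewrite ltnS in lt_n; apply: leq_trans lt_n; apply: proper_card.
  apply/fintype.properP; split.
    apply/fintype.subsetP => _ /imsetP[x _ ->].
    by apply/imsetP; exists (f * x); rewrite // mulrA ef.
  exists e0; first by apply/imsetP; exists 1; rewrite ?mulr1.
  apply/imsetP => -[x _ E]; apply: nf; rewrite -ef mulrC E mulrA (eqP idf) //.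
exists e0; split=> // f idf Pf ef; apply: contrapT => nf; apply: no; by exists f.
Qed.

Definition atom e := [/\ idempotent e, e <> 0 &
  forall f, idempotent f -> f <> 0 -> e * f = f -> f = e].

Lemma atom_below e : idempotent e -> e <> 0 -> exists2 f, atom f & e * f = f.
Proof.
move=> ide e0.
have [|f [idf [f0 ef] fmin]] := @minimal_idempotent (fun f => f <> 0 /\ e * f = f) e ide.
  by split=> //; exact/eqP.
exists f => //; split=> // g idg g0 fg; apply: fmin => //; split=> //.
by rewrite -fg mulrA ef.
Qed.

(** Some power of ex is an idempotent of the corner, so it is 0 or e. *)
Lemma atom_local e x : atom e -> e * x \in radical \/ exists y, e * x * y = e.
Proof.
case=> ide e0 emin; have [n n0 idn] := idempotent_power (e * x).
have en : e * (e * x) ^+ n = (e * x) ^+ n.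
  by rewrite -(prednK n0) exprS !mulrA (eqP ide).
have [z|nz] := eqVneq ((e * x) ^+ n) 0; first by left; exact: nilpotent_radical z.
right; exists ((e * x) ^+ n.-1); rewrite -exprS prednK //; apply: emin => //; exact/eqP.
Qed.

Lemma atoms_orthogonal e f : atom e -> atom f -> e <> f -> e * f = 0.
Proof.
move=> [ide e0 emin] [idf f0 fmin] ef; apply/eqP; apply/negPn/negP => /eqP nz.
have idef : idempotent (e * f) by apply/eqP; rewrite mulrACA (eqP ide) (eqP idf).
apply: ef; rewrite -(emin _ idef nz) ?mulrA ?(eqP ide) //.
by apply: fmin => //; rewrite mulrCA (eqP idf).
Qed.

(** Otherwise some power of z is a nonzero idempotent, and an atom below it
    does not kill z. *)
Lemma radical_separated z : (forall e, atom e -> e * z = 0) -> z \in radical.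
Proof.
move=> ez; have [n n0 idn] := idempotent_power z.
apply: (@nilpotent_radical _ n); apply/eqP; apply/negPn/negP => /eqP nz.
have [e ate ezn] := atom_below idn nz; have [ide e0 _] := ate.
apply: e0; rewrite -ezn -(prednK n0) exprSr -mulrA [z * e]mulrC ez //.
by rewrite mulr0.
Qed.

(** Invertibility can be checked in the two complementary corners. *)
Lemma unit_glue f z w : idempotent f ->
  (exists z', f * z * z' = f) -> (exists w', (1 - f) * w * w' = 1 - f) ->
  f * z + (1 - f) * w \is a GRing.unit.
Proof.
move=> /eqP ff [z' Ez] [w' Ew]; apply/unitrP; exists (f * z' + (1 - f) * w').
have E : (f * z + (1 - f) * w) * (f * z' + (1 - f) * w') = 1.
  have -> : (f * z + (1 - f) * w) * (f * z' + (1 - f) * w') =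
     f * (f * z * z') + (1 - f) * ((1 - f) * w * w') + (f - f * f) * (z * w' + w * z') by ring.
  rewrite Ez Ew ff subrr mul0r addr0 mulrBr mulr1 mulrBl mul1r ff subrr subr0.
  by rewrite addrC subrK.
by rewrite [_ * (f * z + _)]mulrC.
Qed.

Lemma unit_proj f u : f <> 0 -> u \is a GRing.unit -> f * u != 0.
Proof.
by move=> f0 uu; apply: contra_notN f0 => /eqP E; apply: (mulIr uu); rewrite E mul0r.
Qed.

Definition corner e : {set R} := [set e * x | x : R].

Lemma cornerP e x : idempotent e -> reflect (e * x = x) (x \in corner e).
Proof.
move=> /eqP ee; apply: (iffP imsetP) => [[y _ ->]|<-]; first by rewrite mulrA ee.
by exists x.
Qed.

Lemma pick_distinct (A : {set R}) n : (n <= #|A|)%N ->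
  exists x : nat -> R, (forall i, (i < n)%N -> x i \in A) /\
    (forall i j, (i < n)%N -> (j < n)%N -> x i = x j -> i = j).
Proof.
rewrite cardE => nA; exists (nth 0 (enum A)); split=> [i lt_i|i j lt_i lt_j E].
  by rewrite -mem_enum mem_nth // (leq_trans lt_i).
apply/eqP; rewrite -(nth_uniq 0 _ _ (enum_uniq A)) ?E //.
  exact: leq_trans nA.
exact: leq_trans nA.
Qed.

Lemma small_corner e x : idempotent e -> e <> 0 -> (#|corner e| < 3)%N ->
  e * x = 0 \/ e * x = e.
Proof.
move=> ide e0 lt3; have [|x0] := eqVneq (e * x) 0; first by left.
have [|xe] := eqVneq (e * x) e; first by right.
have : (size [:: 0; e; e * x]%R <= #|corner e|)%N.
  rewrite cardE; apply: uniq_leq_size.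
    rewrite eq_sym in x0; rewrite eq_sym in xe.
    by rewrite /= !inE negb_or x0 xe !andbT eq_sym; apply/eqP.
  move=> y; rewrite mem_enum !inE => /or3P[]/eqP->; apply/cornerP => //.
  - by rewrite mulr0.
  - exact/eqP.
  by rewrite mulrA (eqP ide).
by rewrite leqNgt lt3.
Qed.

Lemma field_corner f : atom f -> (forall j, j \in radical -> f * j = 0) ->
  forall x, f * x <> 0 -> exists z, f * x * z = f.
Proof.
move=> atf fJ x fx; have [J|//] := atom_local x atf.
by case: fx; have := fJ _ J; case: atf => /eqP ff _ _; rewrite mulrA ff.
Qed.

Lemma field_pick f n : atom f -> (forall j, j \in radical -> f * j = 0) ->
  (n <= #|corner f|)%N -> exists x : nat -> R,
  (forall i, (i < n)%N -> f * x i = x i) /\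
  (forall i j, (i < n)%N -> (j < n)%N -> i != j -> exists z, f * (x i - x j) * z = f).
Proof.
move=> atf fJ /pick_distinct[x [xf x_inj]]; have [idf _ _] := atf.
have fx i : (i < n)%N -> f * x i = x i by move=> /xf/(cornerP _ idf).
exists x; split=> // i j lti ltj ij; apply: field_corner => //.
rewrite mulrBr !fx // => /eqP; rewrite subr_eq0 => /eqP/(x_inj _ _ lti ltj) E.
by rewrite E eqxx in ij.
Qed.

(** By separation by atoms, it is enough that x is idempotent in each small
    corner. *)
Lemma boolean_off e : idempotent e -> (forall j, j \in radical -> (1 - e) * j = 0) ->
  (forall f, atom f -> f * e = 0 -> (#|corner f| < 3)%N) ->
  forall x, idempotent ((1 - e) * x).
Proof.
move=> ide eJ small x.
have idc := idempotent_compl ide.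
suff : (1 - e) * (x * x - x) = 0.
  move=> E; apply/eqP/eqP; rewrite mulrACA (eqP idc) -subr_eq0 -mulrBr E //.
have J : (1 - e) * (x * x - x) \in radical.
  apply: radical_separated => f atf; have [idf f0 fmin] := atf.
  have [fe|/eqP fe] := eqVneq (f * e) 0.
    rewrite mulrCA mulrBr mulrA; have [->|E] := small_corner x idf f0 (small f atf fe).
      by rewrite mul0r subrr mulr0.
    by rewrite !E subrr mulr0.
  have idfe : idempotent (f * e) by apply/eqP; rewrite mulrACA (eqP ide) (eqP idf).
  have E : f * e = f by apply: fmin => //; rewrite mulrA (eqP idf).
  by rewrite mulrA (_ : f * (1 - e) = 0) ?mul0r // mulrBr mulr1 E subrr.
by rewrite -(eJ _ J) mulrA (eqP idc).
Qed.

(** Translation by j permutes A, so the sum of A is unchanged. *)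
Lemma translation_card (A : {set R}) j : (forall x, x \in A -> x + j \in A) -> j *+ #|A| = 0.
Proof.
move=> Aj.
have E : [set x + j | x in A] = A.
  apply/eqP; rewrite eqEcard card_imset; last exact: addIr.
  by rewrite leqnn andbT; apply/fintype.subsetP => _ /imsetP[x /Aj xA ->].
have : \sum_(x in A) x = \sum_(x in A) x + j *+ #|A|.
  by rewrite -{1}E big_imset /=; [rewrite big_split sumr_const | move=> x y _ _; exact: addIr].
by move=> /eqP; rewrite -{1}[\sum_(x in A) x]addr0 (inj_eq (addrI _)) => /eqP.
Qed.

Lemma additive_order p : prime p -> (p %| #|R|)%N -> exists2 x : R, x != 0 & x *+ p = 0.
Proof.
move=> pp; rewrite -cardsT => /(Cauchy pp)[x _ ox]; exists x.
  by apply: contra_eqN ox => /eqP->; rewrite order1 neq_ltn prime_gt1.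
by have := expg_order x; rewrite ox.
Qed.
End FiniteRing.

(** * Unit graphs that admit no crossing system *)

Section Obstructions.
Variable R : finComUnitRingType.
Implicit Types (e f x y z : R).

Lemma unit_graph_obstruction n Ps (rule : rel nat) (h : nat -> R) :
  refuted Ps ->
  all (fun ab => [&& (ab.1 < n)%N, (ab.2 < n)%N, ab.1 != ab.2 & rule ab.1 ab.2]) (k33_edges Ps) ->
  (forall i j, (i < n)%N -> (j < n)%N -> h i = h j -> i = j) ->
  (forall i j, (i < n)%N -> (j < n)%N -> rule i j -> h i + h j \is a GRing.unit) ->
  ~ crosscap_system (@adj (unit_graph R)).
Proof.
move=> ref /allP edges h_inj h_adj; apply: (refuted_not_subgraph (f := h) ref).
  have lt_n i : i \in [pred i | has (fun g => (i == g.1) || (i == g.2))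
      (k33_edges Ps)] -> (i < n)%N.
    by case/hasP=> ab /edges/and4P[a b _ _] /orP[]/eqP->.
  by move=> i j /lt_n lti /lt_n ltj; exact: h_inj.
move=> ab /edges/and4P[a b nab rab]; rewrite /= /unit_adj h_adj // andbT.
by apply: contra nab => /eqP /h_inj -> .
Qed.

(** The bipartite obstructions all arise in this way. One side consists of sums
    x(i) + v(a), the other of - x(j) + w(b), with x in the corner f and v, w in
    the complementary one; their sum is invertible in the corner f when i
    differs from j, and in the other one by the last hypothesis. Vertices are
    numbered by pairs, i being the quotient. *)
Lemma grid_obstruction (p s t m k : nat) Ps (rule : rel nat) f (x v w : nat -> R) :
  refuted Ps -> (m <= p * s)%N -> (k <= p * t)%N -> (0 < s)%N -> (0 < t)%N ->
  all (fun ab => [&& (ab.1 < m)%N, (m <= ab.2)%N, (ab.2 < m + k)%N,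
    (ab.1 %/ s != (ab.2 - m) %/ t)%N & rule (ab.1 %% s)%N ((ab.2 - m) %% t)%N]) (k33_edges Ps) ->
  idempotent f -> f <> 0 ->
  (forall i, (i < p)%N -> f * x i = x i) ->
  (forall i j, (i < p)%N -> (j < p)%N -> i != j -> exists z, f * (x i - x j) * z = f) ->
  (forall i, (i < s)%N -> (1 - f) * v i = v i) ->
  (forall i, (i < t)%N -> (1 - f) * w i = w i) ->
  (forall i j, (i < s)%N -> (j < s)%N -> v i = v j -> i = j) ->
  (forall i j, (i < t)%N -> (j < t)%N -> w i = w j -> i = j) ->
  (forall i j, (i < s)%N -> (j < t)%N -> v i <> w j) ->
  (forall i j, (i < s)%N -> (j < t)%N -> rule i j ->
     exists z, (1 - f) * (v i + w j) * z = 1 - f) ->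
  ~ crosscap_system (@adj (unit_graph R)).
Proof.
move=> ref mps kpt s0 t0 /allP edges idf f0 fx xx fv fw v_inj w_inj vw rvw.
have ff : f * f = f by exact/eqP.
have fc (y : R) : f * ((1 - f) * y) = 0 by rewrite mulrA mulrBr mulr1 ff subrr mul0r.
have cf (y : R) : (1 - f) * (f * y) = 0 by rewrite mulrA mulrBl mul1r ff subrr mul0r.
have x_inj i j : (i < p)%N -> (j < p)%N -> x i = x j -> i = j.
  move=> lti ltj E; apply/eqP; apply/negPn/negP => ij; have [z] := xx i j lti ltj ij.
  by rewrite E subrr mulr0 mul0r => /esym.
pose l i := x (i %/ s)%N + v (i %% s)%N.
pose r j := - x (j %/ t)%N + w (j %% t)%N.
have div_s i : (i < m)%N -> (i %/ s < p)%N by move=> im; rewrite ltn_divLR //; exact: leq_trans mps.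
have div_t i : (i < k)%N -> (i %/ t < p)%N by move=> im; rewrite ltn_divLR //; exact: leq_trans kpt.
have cfix (y z : R) : f * y = y -> (1 - f) * z = z ->
    f * (y + z) = y /\ (1 - f) * (y + z) = z.
  move=> yf zf; have fz : f * z = 0 by rewrite -zf fc.
  have fy : (1 - f) * y = 0 by rewrite -yf cf.
  by rewrite !mulrDr yf zf fz fy addr0 add0r.
have fl i : (i < m)%N -> f * l i = x (i %/ s)%N /\ (1 - f) * l i = v (i %% s)%N.
  by move=> im; apply: cfix; [rewrite fx ?div_s | rewrite fv ?ltn_mod].
have fr i : (i < k)%N -> f * r i = - x (i %/ t)%N /\ (1 - f) * r i = w (i %% t)%N.
  by move=> im; apply: cfix; [rewrite mulrN fx ?div_t | rewrite fw ?ltn_mod].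
pose h i := if (i < m)%N then l i else r (i - m)%N.
pose rule' i j := [&& (i < m)%N, (m <= j)%N, (j < m + k)%N,
  (i %/ s != (j - m) %/ t)%N & rule (i %% s)%N ((j - m) %% t)%N].
apply: (@unit_graph_obstruction (m + k) Ps rule' h ref).
- apply/allP => ab /edges/and5P[a b c d e]; rewrite /rule' a b c d e !andbT.
  by rewrite (leq_trans a) ?leq_addr //= neq_ltn (leq_trans a b).
- have rk i : (i < m + k)%N -> (i < m)%N = false -> (i - m < k)%N.
    by move=> imk /negbT; rewrite -leqNgt => mi; rewrite ltn_subLR.
  move=> i j lti ltj; rewrite /h; case: ifP => im; case: ifP => jm E.
  + have [a b] := fl i im; have [c d] := fl j jm.
    rewrite (divn_eq i s) (divn_eq j s); congr (_ * _ + _)%N.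
      by apply: x_inj; rewrite ?div_s // -a -c E.
    by apply: v_inj; rewrite ?ltn_mod // -b -d E.
  + have [_ b] := fl i im; have [_ d] := fr _ (rk j ltj jm).
    by case: (vw (i %% s)%N ((j - m) %% t)%N); rewrite ?ltn_mod // -b -d E.
  + have [_ b] := fl j jm; have [_ d] := fr _ (rk i lti im).
    by case: (vw (j %% s)%N ((i - m) %% t)%N); rewrite ?ltn_mod // -b -d E.
  + have [a b] := fr _ (rk i lti im); have [c d] := fr _ (rk j ltj jm).
    have : (i - m = j - m)%N.
      rewrite (divn_eq (i - m) t) (divn_eq (j - m) t); congr (_ * _ + _)%N.
        by apply: x_inj; rewrite ?div_t ?rk //; apply: oppr_inj; rewrite -a -c E.
      by apply: w_inj; rewrite ?ltn_mod // -b -d E.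
    by move: im jm => /negbT + /negbT; rewrite -!leqNgt; lia.
move=> i j lti ltj /and5P[im mj jmk ab rij]; rewrite /h im ltnNge mj /=.
have jk : (j - m < k)%N by rewrite ltn_subLR.
have -> : l i + r (j - m)%N = f * (x (i %/ s)%N - x ((j - m) %/ t)%N) +
    (1 - f) * (v (i %% s)%N + w ((j - m) %% t)%N).
  by rewrite mulrBr mulrDr !fx ?div_s ?div_t // fv ?ltn_mod // fw ?ltn_mod // /l /r addrACA.
apply: unit_glue => //; first by apply: xx; rewrite ?div_s ?div_t.
by apply: rvw; rewrite ?ltn_mod.
Qed.

Local Notation J := (radical R).

Lemma unit_addJl j u : u \is a GRing.unit -> j \in J -> j + u \is a GRing.unit.
Proof. by move=> uu jJ; rewrite addrC unit_addJ. Qed.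

(** The cosets of 0 and 1 are completely joined. *)
Lemma radical_ge4_obstruction : (4 <= #|J|)%N -> ~ crosscap_system (@adj (unit_graph R)).
Proof.
move=> /pick_distinct[a [aJ a_inj]].
pose h i := if (i < 4)%N then a i else 1 + a (i - 4)%N.
pose rule (i j : nat) := (i < 4)%N && (4 <= j)%N.
have lr i j : (i < 4)%N -> (j < 4)%N -> a i <> 1 + a j.
  move=> i4 j4 E; have := aJ i i4; rewrite E radical_unit //.
  by apply: unit_addJ; rewrite ?unitr1 ?aJ.
apply: (@unit_graph_obstruction 8 _ rule h k44_minus_edge_refuted).
- by vm_compute.
- move=> i j i8 j8; rewrite /h; case: ltnP => i4; case: ltnP => j4.
  + exact: a_inj.
  + by move/lr; case => //; lia.
  + by move/esym/lr; case => //; lia.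
  move=> E; have ? : (i - 4 = j - 4)%N by (apply: a_inj (addrI _ E); lia).
  by lia.
move=> i j i8 j8 /andP[i4 j4]; rewrite /h i4 ltnNge j4 /= addrCA.
apply: unit_addJ; rewrite ?unitr1 // radicalD ?aJ //; lia.
Qed.

(** The coset of 0 is completely joined to those of 1 and -1. *)
Lemma radical_eq3_obstruction : #|J| = 3%N -> ~ crosscap_system (@adj (unit_graph R)).
Proof.
move=> J3; have /pick_distinct[a [aJ a_inj]] : (3 <= #|J|)%N by rewrite J3.
(* an element of order 3 forbids 2 in the radical, for then 3 would be a unit *)
have J2 : (1 + 1 \in J) = false.
  apply/negP => two; have u3 : (1 + 1 + 1 : R) \is a GRing.unit.
    by rewrite unit_addJl ?unitr1.
  have E i : (i < 3)%N -> a i = 0.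
    move=> i3; apply: (mulrI u3); rewrite mulr0 !mulrDl mul1r.
    have := @translation_card _ J (a i) (fun x xJ => radicalD xJ (aJ i i3)).
    by rewrite J3 !mulrS mulr0n addr0 addrA.
  by have := a_inj 0 1 isT isT; rewrite !E // => /(_ erefl).
have lr u i j : u \is a GRing.unit -> (i < 3)%N -> (j < 3)%N -> a i <> u + a j.
  move=> uu i3 j3 E; have := aJ i i3; rewrite E radical_unit //.
  by apply: unit_addJ; rewrite ?aJ.
have rr i j : (i < 3)%N -> (j < 3)%N -> 1 + a i <> -1 + a j.
  move=> i3 j3 E; have : 1 + 1 = a j - a i.
    by apply: (addIr (a i)); rewrite subrK -addrA E addrA subrr add0r.
  by move=> E2; move: J2; rewrite E2 radicalD ?radicalN ?aJ.
pose h i := if (i < 3)%N then a i else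
  if (i < 6)%N then 1 + a (i - 3)%N else -1 + a (i - 6)%N.
pose rule (i j : nat) := (i < 3)%N && (3 <= j)%N.
apply: (@unit_graph_obstruction 8 _ rule h k35_refuted).
- by vm_compute.
- have uN1 : -1 \is a (@GRing.unit R) by rewrite unitrN1.
  move=> i j i8 j8; rewrite /h; case: (ltnP i 3) => i3; case: (ltnP j 3) => j3;
    case: (ltnP i 6) => i6; case: (ltnP j 6) => j6 E; try lia;
  first [ by apply: a_inj E; lia
        | by case: (lr _ _ _ _ _ _ E); rewrite ?unitr1 //; lia
        | by case: (lr _ _ _ _ _ _ (esym E)); rewrite ?unitr1 //; lia
        | by case: (rr _ _ _ _ E); lia
        | by case: (rr _ _ _ _ (esym E)); lia
        | (have ? : (i - 3 = j - 3)%N by (apply: a_inj (addrI _ E); lia)); lia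
        | (have ? : (i - 6 = j - 6)%N by (apply: a_inj (addrI _ E); lia)); lia ].
move=> i j i8 j8 /andP[i3 j3]; rewrite /h i3 ltnNge j3 /=.
have i3' := aJ i i3.
case: ltnP => j6; rewrite addrCA; apply: unit_addJ; rewrite ?unitr1 ?unitrN1 //;
  rewrite radicalD ?aJ //; lia.
Qed.

(** Distinct x and y are nonadjacent only if x = - y. So 0 and three pairs of
    opposite elements span K_{1,2,2,2}, and in characteristic 2 any 7 elements
    contain it; sigma gives the position of the opposite element. *)
Lemma field_ge7_obstruction : (forall x : R, x != 0 -> x \is a GRing.unit) ->
  (7 <= #|R|)%N -> ~ crosscap_system (@adj (unit_graph R)).
Proof.
move=> fld R7.
suff [s [sigma [us s7 sN]]] : exists (s : seq R) (sigma : nat -> nat), [/\ uniq s, size s = 7 &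
    forall i, (i < 7)%N -> - nth 0 s i = nth 0 s (sigma i) /\
      (sigma i < 7)%N && ((sigma i == i) || (sigma i == nth 0%N [:: 0; 2; 1; 4; 3; 6; 5] i)%N)].
  pose rule i j := (i != j) && (j != nth 0%N [:: 0; 2; 1; 4; 3; 6; 5] i).
  apply: (@unit_graph_obstruction 7 _ rule (nth 0 s) k1222_refuted).
  - by vm_compute.
  - by move=> i j i7 j7 E; apply/eqP; rewrite -(nth_uniq 0 _ _ us) ?s7 // E.
  move=> i j i7 j7 /andP[ij nij]; apply: fld.
  have [Ni /andP[si7 sig]] := sN i i7.
  rewrite addrC addr_eq0 Ni nth_uniq ?s7 //.
  by case/orP: sig => /eqP->; rewrite // eq_sym.
have pick (s : seq R) : (size s < 7)%N -> exists x, x \notin s.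
  by move=> s7; have [x _ xs] := exists_in_notin (leq_trans s7 R7); exists x.
have [two|two] := eqVneq (1 + 1 : R) 0.
  exists (take 7 (enum R)), id; split.
  - by rewrite take_uniq // enum_uniq.
  - by rewrite size_takel // -cardE.
  move=> i i7; rewrite i7 eqxx; split=> //; apply/eqP; rewrite eq_sym -addr_eq0.
  by rewrite -[X in X + _]mulr1 -[X in _ + X]mulr1 -mulrDr two mulr0.
have NN x : x != 0 -> x != - x.
  move=> x0; rewrite -addr_eq0 -[X in X + _]mul1r -[X in _ + X]mul1r -mulrDl.
  by apply: contra x0 => /eqP E; apply/eqP; apply: (mulrI (fld _ two)); rewrite E mulr0.
have [b] := pick [:: 0; 1; -1] isT; rewrite !inE !negb_or => /and3P[b0 b1 bN1].
have [c] := pick [:: 0; 1; -1; b; -b] isT.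
rewrite !inE !negb_or => /and5P[c0 c1 cN1 cb cNb].
exists [:: 0; 1; -1; b; -b; c; -c], (nth 0%N [:: 0; 2; 1; 4; 3; 6; 5]%N); split=> //.
  have o1 := oner_neq0 R.
  rewrite /= !inE !negb_or; do !(apply/andP; split) => //;
  first [ by rewrite eq_sym ?oppr_eq0 | by apply: NN | by rewrite eqr_opp eq_sym
        | by rewrite eq_sym eqr_oppLR ].
do 7?[case=> [|]] => //= _; rewrite ?oppr0 ?opprK; split=> //.
Qed.

End Obstructions.

Section Cases.
Variable R : finComUnitRingType.
Implicit Types (e f x y z : R).
Local Notation J := (radical R).
Local Notation system := (crosscap_system (@adj (unit_graph R))).

Lemma compl_neq0 e : e <> 1 -> 1 - e <> 0.
Proof. by move=> e1 /eqP; rewrite subr_eq0 => /eqP /esym. Qed.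

(** The complementary corner serves as a bipartition: only differences in the
    corner e matter, which gives K_{5,5} minus a perfect matching. *)
Lemma one_corner_obstruction e : atom e -> e <> 1 -> (forall j, j \in J -> e * j = 0) ->
  (5 <= #|corner e|)%N -> ~ system.
Proof.
move=> ate e1 eJ c5; have [ide e0 _] := ate.
have [x [ex xx]] := field_pick ate eJ c5.
have c0 := compl_neq0 e1; have idc := idempotent_compl ide.
apply: (@grid_obstruction R 5 1 1 4 5 _ (fun _ _ => true) e x (fun=> 0) (fun=> 1 - e)
  k45_minus_matching_refuted) => //.
- by move=> i _; rewrite mulr0.
- by move=> i _; exact/eqP.
- by move=> [|i] [|j].
- by move=> [|i] [|j].
- by move=> i j _ _ /esym.
by move=> i j _ _ _; exists 1; rewrite add0r mulr1; apply/eqP.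
Qed.

(** With two units 1 - e and 1 - e - f + u of the complementary corner, the
    differences in the corner e give the cube with one side doubled. *)
Lemma two_corners_obstruction e f : atom e -> atom f -> e * f = 0 ->
  (forall j, j \in J -> j = 0) -> (4 <= #|corner e|)%N -> (3 <= #|corner f|)%N -> ~ system.
Proof.
move=> ate atf ef J0 c4 c3; have [ide e0 _] := ate; have [idf f0 _] := atf.
have eJ g j : j \in J -> g * j = 0 by move=> /J0 ->; rewrite mulr0.
have [x [ex xx]] := field_pick ate (eJ e) c4.
have idc := idempotent_compl ide; have /eqP ff := idf.
have [u /(cornerP _ idf) fu] := @exists_in_notin _ (mem (corner f)) [:: 0; f] c3.
rewrite !inE negb_or => /andP[/eqP u0 /eqP uf].
have [u' uu'] : exists z, f * u * z = f by apply: field_corner => //; [exact: eJ | rewrite fu].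
have cf : (1 - e) * f = f by rewrite mulrBl mul1r ef subr0.
have cc : (1 - e) * (1 - e) = 1 - e by exact/eqP.
have c0 : 1 - e <> 0 by move=> E; apply: f0; rewrite -cf E mul0r.
pose w (i : nat) := if i == 0%N then 1 - e else 1 - e - f + u.
have fw1 : f * (1 - e - f + u) = u.
  by rewrite mulrDr mulrBr mulrC cf ff subrr add0r fu.
have cw1 : (1 - e) * (1 - e - f + u) = 1 - e - f + u.
  by rewrite mulrDr mulrBr cc cf -[in (1 - e) * u]fu mulrA cf fu.
apply: (@grid_obstruction R 4 1 2 4 8 _ (fun _ _ => true) e x (fun=> 0) w
  half_doubled_cube_refuted) => //.
- by move=> i _; rewrite mulr0.
- by move=> [|[|//]] _; rewrite /w /=.
- by move=> [|i] [|j].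
- have ne : 1 - e <> 1 - e - f + u.
    by move=> /(congr1 ( *%R f)); rewrite fw1 mulrC cf => /esym.
  by move=> [|[|//]] [|[|//]] // _ _; rewrite /w /= => E; case: ne.
- move=> i [|[|//]] _ _; rewrite /w /= => E; first exact: c0.
  by apply: u0; rewrite -fw1 -E mulr0.
move=> i [|[|//]] _ _ _; rewrite add0r /w /=; first by exists 1; rewrite mulr1.
exists (1 - e - f + f * u').
have eqe : (1 - e) * (1 - e - f) = 1 - e - f by rewrite mulrBr cc cf.
have fe0 : f * (1 - e - f) = 0 by rewrite mulrBr mulrC cf ff subrr.
have ue0 : u * (1 - e - f) = 0 by rewrite -fu -mulrA mulrCA fe0 mulr0.
have gf0 : (1 - e - f) * f = 0 by rewrite mulrC.
have gg : (1 - e - f) * (1 - e - f) = 1 - e - f by rewrite [LHS]mulrBl eqe fe0 subr0.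
have [g gE] : exists g, g = 1 - e - f by exists (1 - e - f).
rewrite cw1; rewrite -!gE in gg ue0 gf0 *.
rewrite mulrDl !mulrDr gg ue0 !mulrA gf0 mul0r addr0 add0r.
by rewrite [u * f]mulrC uu' gE subrK.
Qed.

(** Adding elements of the radical does not affect invertibility, so the
    hexagon given by three elements of the corner f is doubled. *)
Lemma doubled_corner_obstruction f j : atom f -> (forall i, i \in J -> f * i = 0) ->
  j \in J -> j <> 0 -> (3 <= #|corner f|)%N -> ~ system.
Proof.
move=> atf fJ jJ j0 c3; have [idf f0 _] := atf; have /eqP cc := idempotent_compl idf.
have [x [fx xx]] := field_pick atf fJ c3.
have cj : (1 - f) * j = j by rewrite mulrBl mul1r fJ // subr0.
pose v (i : nat) : R := if i == 0%N then 0 else j.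
have vJ i : v i \in J by rewrite /v; case: eqP; rewrite ?radical0.
have cv i : (1 - f) * v i = v i by rewrite /v; case: eqP; rewrite ?mulr0.
have v_inj i i' : (i < 2)%N -> (i' < 2)%N -> v i = v i' -> i = i'.
  by case: i i' => [|[|//]] [|[|//]] // _ _; rewrite /v /= => E; case: j0.
apply: (@grid_obstruction R 3 2 2 6 6 _ (fun _ _ => true) f x v (fun i => 1 - f + v i)
  doubled_hexagon_refuted) => //.
- by move=> i _; rewrite [LHS]mulrDr cc cv.
- by move=> i i' i2 i2' /addrI; exact: v_inj.
- move=> i i' _ _ E; apply: j0; rewrite -cj.
  suff -> : 1 - f = 0 by rewrite mul0r.
  apply: idempotent_radical; first exact: idempotent_compl.
  have -> : 1 - f = v i - v i' by rewrite E addrK.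
  by rewrite radicalD ?radicalN.
move=> i i' _ _ _; pose u := 1 + (v i + v i').
have uu : u \is a GRing.unit by rewrite unit_addJ ?unitr1 ?radicalD.
exists u^-1; have -> : (1 - f) * (v i + (1 - f + v i')) = (1 - f) * u.
  have [c cE] : exists c, c = 1 - f by exists (1 - f).
  by rewrite -!cE /u !mulrDr mulr1 !cE cc !cv addrCA.
by rewrite mulrK.
Qed.

(** A third corner g serves as a bipartition for the pairs of elements of the
    corners e and f. *)
Lemma three_corners_obstruction e f : atom e -> atom f -> e * f = 0 ->
  (forall j, j \in J -> j = 0) -> e + f <> 1 ->
  (3 <= #|corner e|)%N -> (3 <= #|corner f|)%N -> ~ system.
Proof.
move=> ate atf ef J0 ef1 ce cf; have [ide e0 _] := ate; have [idf f0 _] := atf.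
have eJ g j : j \in J -> g * j = 0 by move=> /J0 ->; rewrite mulr0.
have [x [ex xx]] := field_pick ate (eJ e) ce.
have [y [fy yy]] := field_pick atf (eJ f) cf.
have /eqP ee := ide; have /eqP ff := idf.
have [g gE] : exists g, g = 1 - e - f by exists (1 - e - f).
have g0 : g <> 0.
  by move=> gz; apply: ef1; apply/esym/eqP; rewrite -subr_eq0 opprD addrA -gE gz.
have cE : 1 - e = f + g by rewrite gE [RHS]addrC subrK.
have gf : g * f = 0 by rewrite gE !mulrBl mul1r ef ff subr0 subrr.
have gg : g * g = g.
  by rewrite {2}gE mulrBr gf subr0 mulrBr mulr1 {2}gE !mulrBl mul1r ee [f * e]mulrC ef
     subrr !subr0.
have gy i : (i < 3)%N -> g * y i = 0 by move=> i3; rewrite -fy // mulrA gf mul0r.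
have y_inj i i' : (i < 3)%N -> (i' < 3)%N -> y i = y i' -> i = i'.
  move=> i3 i3' E; apply/eqP; apply/negPn/negP => ii; have [z] := yy i i' i3 i3' ii.
  by rewrite E subrr mulr0 mul0r => /esym.
apply: (@grid_obstruction R 3 3 3 9 9 _ (fun b d => b != d) e x y (fun d => g - y d)
  nine_cover_refuted) => //.
- by move=> i i3; rewrite cE mulrDl fy // gy // addr0.
- move=> i i3; rewrite cE mulrBr !mulrDl gg fy // gy // addr0.
  by rewrite [f * g]mulrC gf add0r.
- by move=> i i' i3 i3' /addrI /oppr_inj; exact: y_inj.
- move=> i i' i3 i3' E; apply: g0.
  by have := congr1 ( *%R g) E; rewrite mulrBr gg !gy // subr0 => /esym.
move=> i i' i3 i3' ii; have [z Ez] := yy i i' i3 i3' ii; exists (f * z + g).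
have fg : f * g = 0 by rewrite mulrC.
have [d dE] : exists d, d = y i - y i' by exists (y i - y i').
rewrite -dE in Ez; have fd : f * d = d by rewrite dE mulrBr !fy.
have gd : g * d = 0 by rewrite dE mulrBr !gy // subr0.
have -> : (1 - e) * (y i + (g - y i')) = d + g.
  by rewrite addrCA -dE cE mulrDl !mulrDr fg fd gg gd add0r addr0.
rewrite mulrDl !mulrDr [d * (f * z)]mulrA [d * f]mulrC Ez [d * g]mulrC gd addr0.
by rewrite mulrA gf mul0r add0r gg cE.
Qed.
End Cases.

(** * Planar unit graphs *)

Definition k4_drawing : seq (int * int) := [:: (0, 0); (9, 0); (4, 9); (4, 3)].

Lemma k4_ok : straight_line_ok k4_drawing (fun a b => a != b).
Proof. by vm_compute. Qed.

Definition cube_drawing : seq (int * int) :=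
  [:: (0, 0); (3, 7); (9, 9); (6, 2); (7, 6); (9, 0); (2, 3); (0, 9)].

(** The cube as K_{4,4} minus a perfect matching. *)
Definition cube_adj : rel nat := fun a b =>
  ((a < 4) != (b < 4))%N && (a %% 4 != b %% 4)%N.

Lemma cube_ok : straight_line_ok cube_drawing cube_adj.
Proof. by vm_compute. Qed.

Definition wheel_drawing : seq (int * int) := [:: (4, 4); (0, 1); (9, 0); (8, 9); (1, 8)].

Definition wheel_adj : rel nat := fun a b =>
  (a != b) && [|| a == 0%N, b == 0%N | odd a != odd b].

Lemma wheel_ok : straight_line_ok wheel_drawing wheel_adj.
Proof. by vm_compute. Qed.

Definition nine_drawing : seq (int * int) :=
  [:: (5, 4); (4, 9); (6, 0); (8, 4); (5, 6); (6, 5); (0, 4); (3, 7); (3, 3)].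

(** Pairs of residues modulo 3 whose sum has no zero coordinate. *)
Definition nine_adj : rel nat := fun a b =>
  [&& a != b, (a %/ 3 + b %/ 3) %% 3 != 0 & (a %% 3 + b %% 3) %% 3 != 0]%N.

Lemma nine_ok : straight_line_ok nine_drawing nine_adj.
Proof. by vm_compute. Qed.

Section Planar.
Variables (K : realType) (R : finComUnitRingType).
Implicit Types (e f x y z : R).
Local Notation planar := (crosscap_embeddable K (unit_graph R) 0).

Lemma planar_le4 : (#|R| <= 4)%N -> planar.
Proof.
move=> R4; apply: (@straight_line_planar K (unit_graph R) _ _ (fun=> 0%N)
  (fun x : R => enum_rank x) k4_ok).
- by move=> x; exact: leq_trans (ltn_ord _) R4.
- by move=> x y [] /val_inj/enum_rank_inj.
move=> x y /andP[xy _]; split=> //; apply: contra xy => /eqP /val_inj/enum_rank_inj -> //.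
Qed.

Lemma index_inj_in (T : eqType) (s : seq T) (x y : T) :
  x \in s -> index x s = index y s -> x = y.
Proof.
move=> xs E; have ys : y \in s by rewrite -index_mem -E index_mem.
by rewrite -(nth_index x xs) E nth_index.
Qed.

(** In the boolean corner g = 1 - e the only unit is g, so adjacent x and y
    satisfy gy = g - gx, and a component is determined by this unordered pair.
    Within a component, the side tells which of the two elements is gx, and ex
    differs from - ey for adjacent x and y: a subgraph of the cube. *)
Lemma planar_boolean_off e : idempotent e -> e <> 0 -> e <> 1 -> (#|corner e| <= 4)%N ->
  (forall x, idempotent ((1 - e) * x)) -> planar.
Proof.
move=> ide e0 e1 c4 bool_off; have /eqP ee := ide.
have [g gE] : exists g, g = 1 - e by exists (1 - e).
have idg : idempotent g by rewrite gE; exact: idempotent_compl.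
have /eqP gg := idg.
have g0 : g <> 0 by rewrite gE; exact: compl_neq0.
have boolg x : g * x * (g * x) = g * x by rewrite gE; apply/eqP; exact: bool_off.
pose other x := g - g * x.
have other_neq x : other x <> g * x.
  move=> E; apply: g0; have : g * x * other x = 0.
    by rewrite mulrBr boolg mulrAC gg subrr.
  rewrite E boolg => z; move: E; rewrite /other z subr0 //.
pose rk (x : R) : nat := enum_rank x.
have rk_inj : injective rk by move=> x y /val_inj/enum_rank_inj.
pose side x := (rk (g * x)%R < rk (other x))%N.
pose comp x := minn (rk (g * x)) (rk (other x)).
pose lab x := index (if side x then e * x else - (e * x)) (enum (corner e)).
pose pos x := (if side x then lab x else 4 + lab x)%N.
have value_in x : (if side x then e * x else - (e * x)) \in enum (corner e).
  rewrite mem_enum; apply/cornerP => //; case: ifP => _; by rewrite ?mulrN mulrA ee.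
have lab_lt4 x : (lab x < 4)%N.
  by apply: leq_trans c4; rewrite cardE index_mem.
have side_comp x : comp x = if side x then rk (g * x) else rk (other x).
  by rewrite /comp /side /minn.
have split_x x : x = e * x + g * x by rewrite gE -mulrDl addrC subrK mul1r.
apply: (@straight_line_planar K (unit_graph R) _ _ comp pos cube_ok).
- by move=> x; rewrite /pos; have := lab_lt4 x; case: (side x) => /=; lia.
- move=> x y [cxy pxy].
  have sxy : side x = side y.
    by move: pxy; rewrite /pos; have := lab_lt4 x; have := lab_lt4 y;
      case: (side x); case: (side y); lia.
  have lxy : lab x = lab y by move: pxy; rewrite /pos sxy; case: (side y) => // /addnI.
  have exy := index_inj_in (value_in x) lxy.
  have exy' : e * x = e * y by move: exy; rewrite sxy; case: (side y) => // /oppr_inj.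
  suff gxy : g * x = g * y by rewrite (split_x x) (split_x y) exy' gxy.
  move: cxy; rewrite !side_comp sxy; case: (side y) => /rk_inj //.
  by move=> /addrI /oppr_inj.
move=> x y /andP[_ u].
have gxy : other x = g * y.
  apply/eqP; rewrite subr_eq addrC -mulrDr; apply/eqP; apply: (mulIr u).
  by rewrite -[g * (x + y) * _]mulrA; have := boolg (x + y); rewrite mulrACA gg.
have gyx : other y = g * x by rewrite /other -gxy /other subKr.
have sxy : side y = ~~ side x.
  rewrite /side gyx -gxy -leqNgt ltn_neqAle.
  have [E|//] := eqVneq (rk (other x)) (rk (g * x)).
  by case: (other_neq x); exact: rk_inj.
split; first by rewrite /comp gyx -gxy minnC.
have nexy : e * x <> - (e * y).
  move=> E; have := unit_proj e0 u; rewrite mulrDr E addNr eqxx //.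
have nlab : lab x != lab y.
  apply/eqP => /(index_inj_in (value_in x)); rewrite sxy; case: (side x) => /= //.
  by move=> E; apply: nexy; rewrite -E opprK.
have lx := lab_lt4 x; have ly := lab_lt4 y.
rewrite /cube_adj /pos sxy; case: (side x) => /=; apply/andP; split.
- by rewrite lx; lia.
- by rewrite modnDl !modn_small.
- by rewrite ly; lia.
- by rewrite modnDl !modn_small.
Qed.

(** The wheel: 0 in the centre, and around it 1, b, -1, -b, where opposite
    elements are not adjacent. *)
Lemma planar_field5 : (forall x : R, x != 0 -> x \is a GRing.unit) -> #|R| = 5%N -> planar.
Proof.
move=> fld R5.
have five : (1 *+ 5 : R) = 0.
  by have := @translation_card R [set: R] 1 (fun x _ => finset.in_setT _); rewrite cardsT R5.
have two : (1 + 1 : R) != 0.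
  apply/eqP => two; have := five; rewrite (_ : 1 *+ 5 = 1 + 1 + (1 + 1) + 1); last by ring.
  by rewrite two !add0r; apply/eqP; exact: oner_neq0.
have NN x : x != 0 -> x != - x.
  move=> x0; rewrite -addr_eq0 -[X in X + _]mul1r -[X in _ + X]mul1r -mulrDl.
  by apply: contra x0 => /eqP E; apply/eqP; apply: (mulrI (fld _ two)); rewrite E mulr0.
have [b _] : exists2 b : R, b \in R & b \notin [:: 0; 1; -1].
  by apply: exists_in_notin; rewrite R5.
rewrite !inE !negb_or => /and3P[b0 b1 bN1].
pose s : seq R := [:: 0; 1; b; -1; -b].
have us : uniq s.
  have o1 := oner_neq0 R.
  rewrite /= !inE !negb_or; do !(apply/andP; split) => //;
  first [ by rewrite eq_sym ?oppr_eq0 | by apply: NN | by rewrite eqr_opp eq_sym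
        | by rewrite eq_sym eqr_oppLR ].
have in_s x : x \in s by apply: (uniq_exhausts us (A := R)) => //; rewrite R5.
have pos5 x : (index x s < 5)%N by rewrite -[5%N]/(size s) index_mem.
have opp_s i : (i < 5)%N -> - nth 0 s i = nth 0 s (nth 0%N [:: 0; 3; 4; 1; 2]%N i).
  by do 5?[case: i => [|i]] => //= _; rewrite ?oppr0 ?opprK.
apply: (@straight_line_planar K (unit_graph R) _ _ (fun=> 0%N) (fun x : R => index x s) wheel_ok).
- exact: pos5.
- by move=> x y [] /(index_inj_in (in_s x)).
move=> x y /andP[xy u]; split=> //.
have ij : index x s != index y s by apply: contra xy => /eqP /(index_inj_in (in_s x)) ->.
have nij : index y s != nth 0%N [:: 0; 3; 4; 1; 2]%N (index x s).
  apply/eqP => E; move: u; have := opp_s _ (pos5 x); rewrite -E !nth_index // => <-.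
  by rewrite subrr unitr0.
move: (index x s) (index y s) (pos5 x) (pos5 y) ij nij => i j.
by do 5?[case: i => [|i]] => //; do 5?[case: j => [|j]].
Qed.

Lemma corner3_uniq e : idempotent e -> e <> 0 -> #|corner e| = 3%N ->
  uniq [:: 0; e; - e].
Proof.
move=> ide e0 c3; have /eqP ee := ide.
have three : e *+ 3 = 0.
  rewrite -c3; apply: translation_card => y /(cornerP _ ide) ey.
  by apply/cornerP => //; rewrite mulrDr ey ee.
rewrite /= !inE !negb_or !andbT ![0 == _]eq_sym oppr_eq0; apply/andP; split.
  by rewrite andbb; apply/eqP.
apply/eqP => E; apply: e0; move: three.
by rewrite !mulrS mulr0n addr0 {2}E addNr addr0.
Qed.

(** A group of order 3 consists of 0, e and - e. *)
Lemma corner3 e : idempotent e -> e <> 0 -> #|corner e| = 3%N ->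
  forall x, e * x \in [:: 0; e; - e].
Proof.
move=> ide e0 c3 x; have /eqP ee := ide.
apply: (uniq_exhausts (A := corner e)); rewrite ?c3 //.
- exact: corner3_uniq.
- move=> y; rewrite !inE => /or3P[]/eqP->; apply/cornerP => //; first by rewrite mulr0.
  by rewrite mulrN ee.
by apply/cornerP => //; rewrite mulrA ee.
Qed.

Lemma planar_nine e f : idempotent e -> idempotent f -> e <> 0 -> f <> 0 -> e + f = 1 ->
  #|corner e| = 3%N -> #|corner f| = 3%N -> planar.
Proof.
move=> ide idf e0 f0 ef1 ce cf.
pose lab g x := index (g * x) [:: 0; g; - g].
have lab3 g x : idempotent g -> g <> 0 -> #|corner g| = 3%N -> (lab g x < 3)%N.
  by move=> idg g0 cg; rewrite /lab -[3%N]/(size [:: 0; g; - g]) index_mem corner3.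
have le x := lab3 e x ide e0 ce; have lf x := lab3 f x idf f0 cf.
pose pos (x : R) := (lab e x * 3 + lab f x)%N.
have pos_e x : (pos x %/ 3 = lab e x)%N by rewrite divnMDl // divn_small ?addn0.
have pos_f x : (pos x %% 3 = lab f x)%N by rewrite modnMDl modn_small.
have pos_inj : injective pos.
  move=> x y E; have := pos_e x; have := pos_f x; rewrite E pos_e pos_f => Ef Ee.
  have xe := index_inj_in (corner3 ide e0 ce x) (esym Ee).
  have xf := index_inj_in (corner3 idf f0 cf x) (esym Ef).
  by rewrite -[x]mul1r -[y]mul1r -ef1 !mulrDl xe xf.
have label_sum_unit g x y : idempotent g -> g <> 0 -> #|corner g| = 3%N ->
    x + y \is a GRing.unit -> ((lab g x + lab g y) %% 3 != 0)%N.
  move=> idg g0 cg u; have := unit_proj g0 u; apply: contraNN => E.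
  have := corner3_uniq idg g0 cg; rewrite /= !inE !negb_or !andbT.
  case/andP=> /andP[z1 z2] z3.
  move: E (corner3 idg g0 cg x) (corner3 idg g0 cg y); rewrite mulrDr /lab.
  rewrite !in_cons !in_nil !orbF.
  move=> E /or3P[]/eqP Ex /or3P[]/eqP Ey; move: E; rewrite Ex Ey /= ?eqxx
    ?(negPf z1) ?(negPf z2) ?(negPf z3) //= => _;
    by rewrite ?addr0 ?subrr ?addNr.
apply: (@straight_line_planar K (unit_graph R) _ _ (fun=> 0%N) pos nine_ok).
- by move=> x; rewrite /pos; have := le x; have := lf x; rewrite /=; lia.
- by move=> x y [] /pos_inj.
move=> x y /andP[xy u]; split=> //; rewrite /nine_adj !pos_e !pos_f !label_sum_unit // !andbT.
by apply: contra xy => /eqP /pos_inj ->.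
Qed.

(** By the order of the radical, then by the number of corners with at least 3
    elements. A field with 6 elements is excluded by Cauchy's theorem, which
    would make both 2 and 3 vanish. *)
Theorem planar_or_obstructed : planar \/ ~ crosscap_system (@adj (unit_graph R)).
Proof.
have id1 : idempotent (1 : R) by rewrite /idempotent mulr1.
have one0 : (1 : R) <> 0 by apply/eqP; exact: oner_neq0.
have corner1 : corner (1 : R) = [set: R].
  by apply/setP => x; rewrite finset.in_setT; apply/cornerP => //; rewrite mul1r.
have [J4|] := leqP 4 #|radical R|; first by right; exact: radical_ge4_obstruction.
rewrite ltnS leq_eqVlt => /predU1P[J3|]; first by right; exact: radical_eq3_obstruction.
rewrite ltnS leq_eqVlt => /predU1P[J2|J1].
  have [j jJ] : exists2 j, j \in radical R & j \notin [:: 0].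
    by apply: exists_in_notin; rewrite J2.
  rewrite inE => /eqP j0.
  have J0j i : i \in radical R -> i = 0 \/ i = j.
    move=> iJ; have : i \in [:: 0; j].
      apply: (uniq_exhausts (A := radical R)) iJ; rewrite ?J2 //.
        by rewrite /= inE andbT eq_sym; apply/eqP.
      by move=> k; rewrite !in_cons orbF => /orP[]/eqP->; rewrite ?radical0.
    by rewrite !inE => /orP[]/eqP->; [left | right].
  have j1 : 1 * j <> 0 by rewrite mul1r.
  have [e [ide ej emin]] := @minimal_idempotent R (fun e => e * j <> 0) 1 id1 j1.
  have ej' : e * j = j by case: (J0j _ (radicalMl e jJ)).
  have e0 : e <> 0 by move=> E; apply: ej; rewrite E mul0r.
  have ate : atom e.
    split=> // f idf f0 ef; have [fj|/eqP fj] := eqVneq (f * j) 0; last exact: emin.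
    have ide_f : idempotent (e - f).
      apply/eqP; rewrite mulrBl !mulrBr (eqP ide) ef [f * e]mulrC ef (eqP idf).
      by rewrite subrr subr0.
    have E : e - f = e.
      apply: emin => //; first by rewrite mulrBl fj subr0 ej'.
      by rewrite mulrBr (eqP ide) ef.
    by case: f0; rewrite -[f]opprK -[- f](addKr e) E addNr oppr0.
  have eJ i : i \in radical R -> (1 - e) * i = 0.
    by move=> /J0j[]->; rewrite ?mulr0 // mulrBl mul1r ej' subrr.
  have [big|nobig] := pselect (exists f, [/\ atom f, f * e = 0 & (3 <= #|corner f|)%N]).
    have [f [atf fe cf]] := big; right.
    apply: (doubled_corner_obstruction atf _ jJ j0 cf) => i /J0j[]->; rewrite ?mulr0 //.
    by rewrite -ej' mulrA fe mul0r.
  have ce : (#|corner e| <= 4)%N.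
    have sub : {subset enum (corner e) <= [:: 0; j; e; e + j]}.
      move=> y; rewrite mem_enum => /(cornerP _ ide) ey.
      have loc z : e * z = z -> z \in radical R \/ exists z', z * z' = e.
        by move=> ez; have := atom_local z ate; rewrite ez.
      have [yJ|[y' yy]] := loc y ey.
        by rewrite !in_cons; case: (J0j y yJ) => ->; rewrite eqxx ?orbT.
      have yj : y * j = j.
        case: (J0j _ (radicalMl y jJ)) => // yj0; case: j0.
        by rewrite -ej' -yy mulrAC yj0 mul0r.
      have ez : e * (y - e) = y - e by rewrite mulrBr ey (eqP ide).
      have [zJ|[z' zz]] := loc _ ez.
        rewrite !in_cons; case: (J0j _ zJ) => E; rewrite -[y](subrK e) E ?add0r ?eqxx ?orbT //.
        by rewrite [j + e]addrC eqxx !orbT.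
      by case: j0; rewrite -ej' -zz mulrAC mulrBl yj ej' subrr mul0r.
    by rewrite cardE; exact: (uniq_leq_size (enum_uniq _) sub).
  left; have [e1|/eqP e1] := eqVneq e 1.
    by apply: planar_le4; move: ce; rewrite e1 corner1 cardsT.
  apply: (planar_boolean_off ide e0 e1 ce); apply: boolean_off => // f atf fe.
  by rewrite ltnNge; apply/negP => cf; apply: nobig; exists f.
have J0 i : i \in radical R -> i = 0.
  move=> iJ; apply/eqP; apply/negPn/negP => i0; move: J1; rewrite ltnS.
  rewrite leqNgt cardE => /negP; apply; apply: (@uniq_leq_size _ [:: 0; i]).
    by rewrite /= inE andbT eq_sym.
  by move=> k; rewrite mem_enum !in_cons orbF => /orP[]/eqP->; rewrite ?radical0.
have gJ g i : i \in radical R -> g * i = 0 by move=> /J0 ->; rewrite mulr0.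
have [[e [f [[ate atf nef] ce cf]]]|notwo] := pselect (exists e f : R,
    [/\ [/\ atom e, atom f & e <> f], (3 <= #|corner e|)%N & (3 <= #|corner f|)%N]).
  have ef := atoms_orthogonal ate atf nef.
  have [ef1|/eqP ef1] := eqVneq (e + f) 1; last first.
    by right; apply: (three_corners_obstruction ate atf ef).
  have [ce4|] := leqP 4 #|corner e|.
    by right; apply: (two_corners_obstruction ate atf ef).
  have [cf4|] := leqP 4 #|corner f|.
    by right; rewrite mulrC in ef; apply: (two_corners_obstruction atf ate ef).
  rewrite !ltnS => cf3 ce3; left.
  have [ide e0 _] := ate; have [idf f0 _] := atf.
  by apply: (planar_nine ide idf e0 f0 ef1); apply/eqP; rewrite eqn_leq ?ce ?cf ?ce3 ?cf3.
have [e ate others] : exists2 e : R, atom e & forall f, atom f -> f * e = 0 -> (#|corner f| < 3)%N.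
  have [[e [ate ce]]|nobig] := pselect (exists e : R, atom e /\ (3 <= #|corner e|)%N).
    exists e => // f atf fe; rewrite ltnNge; apply/negP => cf; apply: notwo.
    exists e, f; split=> //; split=> // E; have [/eqP ee e0 _] := ate.
    by apply: e0; rewrite -ee {1}E.
  have [e ate _] := atom_below id1 one0; exists e => // f atf _.
  by rewrite ltnNge; apply/negP => cf; apply: nobig; exists f.
have [ide e0 _] := ate.
have [e1|/eqP e1] := eqVneq e 1; last first.
  have [c5|c4] := leqP 5 #|corner e|.
    by right; apply: (one_corner_obstruction ate e1) => // j; exact: gJ.
  by left; apply: (planar_boolean_off ide e0 e1 c4); apply: boolean_off => // j; exact: gJ.
have fld (x : R) : x != 0 -> x \is a GRing.unit.
  move=> /eqP x0; have [|z] := field_corner ate (gJ e) (x := x); first by rewrite e1 mul1r.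
  by rewrite e1 mul1r => xz; apply/unitrP; exists z; rewrite mulrC xz.
have [R7|] := leqP 7 #|R|; first by right; exact: field_ge7_obstruction.
rewrite ltnS leq_eqVlt => /predU1P[R6|].
  have [x x0 x2] : exists2 x : R, x != 0 & x *+ 2 = 0 by apply: additive_order; rewrite // R6.
  have [y y0 y3] : exists2 x : R, x != 0 & x *+ 3 = 0 by apply: additive_order; rewrite // R6.
  have two : (2%:R : R) = 0.
    by apply: (mulrI (fld x x0)); rewrite mulr0 mulr_natr.
  have three : (3%:R : R) = 0.
    by apply: (mulrI (fld y y0)); rewrite mulr0 mulr_natr.
  by case: one0; rewrite -[LHS]add0r -{1}two natr1.
rewrite ltnS leq_eqVlt => /predU1P[R5|R4]; left; first exact: planar_field5.
exact: planar_le4.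
Qed.
End Planar.

Theorem corollary4p12 (K : realType) :
  ~ exists R : finComUnitRingType, projective K (unit_graph R).
Proof.
case=> R [emb1 least]; have [planar|obstructed] := planar_or_obstructed K R.
  by have := least 0%N planar.
exact: obstructed (crosscap_embeddable_system emb1).
Qed.
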